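(* For every $p>0$ there exist two constants $c_p>0$ and $C_p>0$, depending only on $p$, such that the following holds. For every filtered probability space $(\Omega,\mathcal{F},(\mathcal{F}_t)_{t\ge 0},\mathbb{P})$ satisfying the usual hypotheses, every continuous $(\mathcal{F}_t)$-local martingale $(M_t)_{t\ge 0}$ with $M_0=0$, and every $(\mathcal{F}_t)$ pseudo-stopping time $\rho$ such that $\mathbb{P}(\rho=\infty)=0$, $$c_p\,\mathbb{E}\left[\left(\langle M\rangle_\rho\right)^{p/2}\right]\le \mathbb{E}\left[\left(M_\rho^{*}\right)^p\right]\le C_p\,\mathbb{E}\left[\left(\langle M\rangle_\rho\right)^{p/2}\right].$$
   Context: The usual hypotheses: the filtration $(\mathcal{F}_t)_{t\ge0}$ is right-continuous and complete. A random time is an $\mathcal{F}$-measurable nonnegative random variable $\rho$ (not necessarily a stopping time). A random time $\rho$ is called an $(\mathcal{F}_t)$ pseudo-stopping time if $\mathbb{E}[M_\rho]=\mathbb{E}[M_0]$ for every bounded $(\mathcal{F}_t)$-martingale $(M_t)$ (martingales are taken in their càdlàg versions). For a continuous local martingale $M$, $\langle M\rangle$ denotes its quadratic variation process (bracket), and $M_\rho^{*}=\sup_{t\le\rho}|M_t|$. Both sides of the inequalities may be $+\infty$. *)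

(* Defs.v *)
From HB Require Import structures.
From mathcomp Require Import all_boot all_order all_algebra.
From mathcomp Require Import all_classical all_reals all_analysis measurable_realfun.

Set Implicit Arguments.
Unset Strict Implicit.
Unset Printing Implicit Defensive.

Import Order.TTheory GRing.Theory Num.Theory.
Import numFieldNormedType.Exports.

Local Open Scope classical_set_scope.
Local Open Scope ring_scope.

(* The time set is [0, +oo[, embedded in R: filtrations and processes are
   indexed by R, but no definition looks at their values at negative times.
   Random times take values in [0, +oo] and are functions to \bar R.
   Path properties and identities between random variables are required
   almost surely. *)

Section processes.
Context d (T : measurableType d) (R : realType) (P : probability T R).
Implicit Types (F : R -> set (set T)) (G : set (set T)).
Implicit Types (X M A : R -> T -> R) (tau rho : T -> \bar R).

Definition filtration F : Prop :=
  [/\ forall t, 0 <= t -> sigma_algebra [set: T] (F t),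
      forall t, 0 <= t -> F t `<=` measurable &
      forall s t, 0 <= s -> s <= t -> F s `<=` F t].

Definition right_continuous_filtration F : Prop :=
  forall t, 0 <= t -> F t = \bigcap_(s in `]t, +oo[) F s.

(* Since F 0 `<=` measurable, this also says that the probability space is
   complete: P.-negligible sets are arbitrary subsets of null events. *)
Definition complete_filtration F : Prop := P.-negligible `<=` F 0.

Definition usual_hypotheses F : Prop :=
  [/\ filtration F, right_continuous_filtration F & complete_filtration F].

Definition measurable_wrt G (Y : T -> R) : Prop :=
  forall B : set R, measurable B -> G (Y @^-1` B).

Definition adapted F X : Prop :=
  forall t, 0 <= t -> measurable_wrt (F t) (X t).

(* Y is a version of the conditional expectation of Z given G. *)
Definition is_cond_expectation G (Z Y : T -> R) : Prop :=
  [/\ measurable_wrt G Y, P.-integrable [set: T] (EFin \o Y) &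
      forall B, G B ->
        (\int[P]_(w in B) (Y w)%:E = \int[P]_(w in B) (Z w)%:E)%E].

Definition martingale F X : Prop :=
  [/\ adapted F X,
      forall t, 0 <= t -> P.-integrable [set: T] (EFin \o X t) &
      forall s t, 0 <= s -> s <= t -> is_cond_expectation (F s) (X t) (X s)].

Definition cadlag_path (x : R -> R) : Prop :=
  (forall t, 0 <= t -> x s @[s --> t^'+] --> x t) /\
  (forall t, 0 < t -> cvg (x s @[s --> t^'-])).

Definition continuous_path (x : R -> R) : Prop :=
  {within `[0, +oo[, continuous x}.

Definition nondecreasing_path (x : R -> R) : Prop :=
  forall s t, 0 <= s -> s <= t -> x s <= x t.

Definition bounded_process X : Prop :=
  exists K : R, forall t w, 0 <= t -> `|X t w| <= K.

Definition stopping_time F tau : Prop :=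
  (forall w, (0 <= tau w)%E) /\
  (forall t, 0 <= t -> F t [set w | (tau w <= t%:E)%E]).

Definition stopped X tau : R -> T -> R :=
  fun t w => X (fine (Order.min t%:E (tau w))) w.

Definition localizing_sequence F (tau : nat -> T -> \bar R) : Prop :=
  [/\ forall n, stopping_time F (tau n),
      \forall w \ae P, nondecreasing_seq (tau ^~ w) &
      \forall w \ae P, tau ^~ w @ \oo --> +oo%E].

(* Localization is applied to X - X_0, so that X_0 need not be integrable. *)
Definition continuous_local_martingale F X : Prop :=
  [/\ adapted F X,
      \forall w \ae P, continuous_path (X ^~ w) &
      exists2 tau, localizing_sequence F tau &
        forall n, martingale F (fun t w => stopped X (tau n) t w - X 0 w)].

(* A is a version of the bracket <M>: the continuous nondecreasing adapted
   process, unique up to indistinguishability, that starts at 0 and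
   compensates M ^ 2. *)
Definition is_bracket F M A : Prop :=
  [/\ adapted F A,
      \forall w \ae P, A 0 w = 0,
      \forall w \ae P, continuous_path (A ^~ w),
      \forall w \ae P, nondecreasing_path (A ^~ w) &
      continuous_local_martingale F (fun t w => M t w ^+ 2 - A t w)].

Definition random_time rho : Prop :=
  measurable_fun [set: T] rho /\ (forall w, (0 <= rho w)%E).

(* X_rho, with X_oo the limit of X_t as t --> +oo. The limit is taken in
   \bar R; where it does not exist, lim returns an arbitrary value (for a
   bounded cadlag martingale this happens only on a null set). *)
Definition at_time X rho (w : T) : \bar R :=
  if rho w is t%:E then (X t w)%:E
  else lim ((X t w)%:E @[t --> +oo%R]).

Definition pseudo_stopping_time F rho : Prop :=
  random_time rho /\
  forall M, martingale F M -> bounded_process M ->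
    (\forall w \ae P, cadlag_path (M ^~ w)) ->
    (\int[P]_w at_time M rho w = 'E_P[M 0%R])%E.

(* M*_rho, the supremum of |M_t| over the finite times t <= rho. *)
Definition running_sup M rho (w : T) : \bar R :=
  ereal_sup [set `|M t w|%:E | t in [set t | 0 <= t /\ (t%:E <= rho w)%E]].

End processes.

(* Main.v *)
Require Import Defs.
From HB Require Import structures.
From mathcomp Require Import all_boot all_order all_algebra.
From mathcomp Require Import all_classical all_reals all_analysis measurable_realfun.
From mathcomp Require Import ring lra.

Set Implicit Arguments.
Unset Strict Implicit.
Unset Printing Implicit Defensive.

Import Order.TTheory GRing.Theory Num.Theory.
Import numFieldNormedType.Exports.

Local Open Scope classical_set_scope.
Local Open Scope ring_scope.

(** The two inequalities follow from good-lambda inequalities, and these only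
use the pseudo-stopping property through bounded martingales, which is all
that its definition offers.

Let S be the minimum of an exit time of M from an interval and an exit time
of the bracket A from an interval. Then the local martingales M and M ^ 2 - A,
stopped at S, are bounded, hence true bounded martingales
([bounded_stopped_martingale]), so that they may be evaluated at the
pseudo-stopping time rho ([pseudo_stopped_mean]):
E M_(S /\ rho) = 0 and E M_(S /\ rho) ^ 2 = E A_(S /\ rho).
So rho behaves like a stopping time in every computation that mixes exit times
of M and A, and the classical argument applies without enlarging the
filtration.

Write M* for the supremum of |M| up to rho. Comparing two exit times S1 <= S2
on each path gives, for all l > 0 and delta > 0,
P(A_rho >= 4 l ^ 2, M* < delta l) <= (delta ^ 2 / 3) P(A_rho >= l ^ 2) and
P(M* >= 2 l, A_rho < (delta l) ^ 2) <= 2 delta ^ 2 P(M* >= l)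
([good_lambda_bracket], [good_lambda_martingale]).
In both cases S1 and S2 differ before rho only if the event on the right occurs,
and on the event on the left the path makes a full excursion between S1 and S2.

Such an inequality between X and Y, with a small enough factor, gives
E X ^ p <= C E Y ^ p with C depending on p only ([good_lambda_moment]). The
tail of X is summed over finitely many dyadic levels only, so that the sum is
finite and can be absorbed, whatever the moments of X. For each p one delta
serves both directions, which yields the same constant C for both and c = 1 / C.

The hypotheses hold almost surely, the argument is pathwise: M and A are first
set to 0 on a null set, and extended by their value at 0 to negative times, so
that all paths become continuous on the whole line ([regularized]). Adaptedness
survives because the filtration is complete. *)

(** * Running maxima and hitting times of a continuous path *)

Section paths.
Context {R : realType}.
Implicit Types (x : R -> R) (a s t : R).

Definition running_max x t : R := sup [set x s | s in `[0, t]%classic].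

Definition hit x a : \bar R :=
  ereal_inf [set t%:E | t in [set t | 0 <= t /\ a <= x t]].

(** The time t /\ S, as a real number: it is finite even where S = +oo. *)
Definition until t (S : \bar R) : R := fine (Order.min t%:E S).

Lemma running_max_attained x t : continuous x -> 0 <= t ->
  exists2 s, 0 <= s <= t & running_max x t = x s.
Proof.
move=> cx t0.
have [s sI smax] := EVT_max t0 (continuous_subspaceT (A := `[0, t]) cx).
exists s; first by rewrite in_itv /= in sI.
have us : ubound [set x s | s in `[0, t]%classic] (x s).
  by move=> _ [u uI <-]; apply: smax.
apply/eqP; rewrite eq_le; apply/andP; split.
  by apply: ge_sup => //; exists (x s), s.
by apply: ub_le_sup; [exists (x s)|exists s].
Qed.

Lemma le_running_max x s t : continuous x -> 0 <= s <= t ->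
  x s <= running_max x t.
Proof.
move=> cx /andP[s0 st]; have t0 := le_trans s0 st.
have [u uI umax] := EVT_max t0 (continuous_subspaceT (A := `[0, t]) cx).
apply: ub_le_sup; last by exists s => //=; rewrite in_itv /= s0.
by exists (x u) => _ [v vI <-]; apply: umax.
Qed.

Lemma lt_hit x a t : 0 <= t -> (t%:E < hit x a)%E -> x t < a.
Proof.
move=> t0; rewrite !ltNge; apply: contra => xt.
by apply: ereal_inf_lbound; exists t.
Qed.

Lemma hit_ge0 x a : (0 <= hit x a)%E.
Proof. by apply: le_ereal_inf_tmp => _ [t [t0 _] <-]; rewrite lee_fin. Qed.

(** The infimum is attained because the path is continuous. This turns hitting
times into running maxima, which are measurable with respect to the past. *)
Lemma hit_le x a t : continuous x -> 0 <= t ->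
  (hit x a <= t%:E)%E = (a <= running_max x t).
Proof.
move=> cx t0; apply/idP/idP => [ht|]; last first.
  have [s /andP[s0 st] ->] := running_max_attained cx t0 => xs.
  apply: (@le_trans _ _ s%:E); last by rewrite lee_fin.
  by apply: ereal_inf_lbound; exists s.
rewrite leNgt; apply/negP => xa.
have xta s : 0 <= s <= t -> x s < a.
  by move=> st; apply: le_lt_trans xa; apply: le_running_max.
have /(_ _)/nbhs_ballP[|e /= e0 be] := cx t [set y | y < a].
  by apply: open_nbhs_nbhs; split; [exact: open_lt|apply: xta; rewrite t0 lexx].
suff : ((t + e)%:E <= hit x a)%E.
  by move=> /le_trans/(_ ht); rewrite lee_fin; move: e0; clear; lra.
apply: le_ereal_inf_tmp => _ [s [s0 xs] <-]; rewrite lee_fin leNgt.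
apply/negP => ste; move: xs; rewrite leNgt => /negP; apply.
have [st|ts] := leP s t; first by apply: xta; rewrite s0.
by apply: be; rewrite /ball /= ltr_norml; move: ste ts; clear; lra.
Qed.

Lemma hit_le_self x a t : continuous x -> 0 <= t -> a <= x t ->
  (hit x a <= t%:E)%E.
Proof. by move=> cx t0 xt; apply: ereal_inf_lbound; exists t. Qed.

(** By continuity a path that starts below its target cannot overshoot it. *)
Lemma hit_value x a h : continuous x -> x 0 <= a -> hit x a = h%:E -> x h = a.
Proof.
move=> cx x0 hE; have h0 : 0 <= h by rewrite -lee_fin -hE hit_ge0.
have : (hit x a <= h%:E)%E by rewrite hE.
rewrite hit_le//; have [s /andP[s0 sh] ->] := running_max_attained cx h0 => xs.
have hs : (h%:E <= s%:E)%E by rewrite -hE; exact: hit_le_self.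
have sE : s = h by apply/eqP; rewrite eq_le sh -lee_fin hs.
rewrite sE in xs; apply/eqP; rewrite eq_le xs andbT leNgt; apply/negP => xh.
have h1 : 0 < h.
  by rewrite lt_neqAle h0 andbT; apply: contraTneq xh => <-; rewrite -leNgt.
have /(_ _)/nbhs_ballP[|e /= e0 be] := cx h [set y | a < y].
  by apply: open_nbhs_nbhs; split => //; exact: open_gt.
pose u := Num.max 0 (h - e / 2).
have [u0 uh] : 0 <= u /\ u < h.
  by rewrite /u le_max lexx gt_max h1; split=> //=; move: e0; clear; lra.
have : a < x u.
  apply: be; rewrite /ball /= ltr_norml /u.
  have := le_max (h - e / 2) 0 (h - e / 2).
  by rewrite lexx orbT -/u; move: uh e0; rewrite /u; clear; lra.
apply/negP; rewrite -leNgt; apply/ltW/lt_hit => //; by rewrite hE lte_fin.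
Qed.

Lemma le_hit x a t : continuous x -> x 0 <= a -> 0 <= t ->
  (t%:E <= hit x a)%E -> x t <= a.
Proof.
move=> cx x0 t0; rewrite le_eqVlt => /orP[/eqP h|]; last by move=> /lt_hit /ltW->.
by rewrite (@hit_value x a t).
Qed.

Lemma until_itv t S : 0 <= t -> (0 <= S)%E -> 0 <= until t S <= t.
Proof.
rewrite /until; case: S => [s| |] t0; rewrite ?lee_fin => s0 //.
  by rewrite -EFin_min/= le_min t0 s0 ge_min lexx.
by rewrite miney /= t0 lexx.
Qed.

Lemma until_le t S : 0 <= t -> (0 <= S)%E -> ((until t S)%:E <= S)%E.
Proof.
rewrite /until; case: S => [s| |] t0; rewrite ?lee_fin => s0 //.
  by rewrite -EFin_min/= ge_min lexx orbT.
by rewrite leey.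
Qed.

Lemma until_id t S : (t%:E <= S)%E -> until t S = t.
Proof. by move=> tS; rewrite /until min_l. Qed.

Lemma until_fin t s : s <= t -> until t s%:E = s.
Proof. by move=> st; rewrite /until -EFin_min/= min_r. Qed.

Lemma untilA t S S' : (0 <= S)%E ->
  until t (Order.min S S') = until (until t S) S'.
Proof.
rewrite /until; case: S => [s| |] // s0.
  by rewrite -EFin_min /= EFin_min minA.
by rewrite minye miney.
Qed.

End paths.

(** * Measurability of a process along a random time *)

Section random_evaluation.
Context {R : realType} d (T : measurableType d).
Implicit Types (X : R -> T -> R) (r : T -> R).

(** The random time is approximated from below by its roundings to multiples
of 1 / (m + 1), so that only the values of X at times bounded by some value of
r are ever used. This covers at once r unbounded with X measurable at all
times, and r <= t with X measurable with respect to the past of t. *)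
Lemma measurable_eval X r :
  (forall w, continuous (X ^~ w)) -> (forall w, 0 <= r w) ->
  measurable_fun setT r ->
  (forall s, 0 <= s -> (exists w, s <= r w) -> measurable_fun setT (X s)) ->
  measurable_fun setT (fun w => X (r w) w).
Proof.
move=> cX r0 mr mX.
pose g m w : R := (Num.truncn (r w * m.+1%:R))%:R / m.+1%:R.
have m0 m : 0 < m.+1%:R :> R by rewrite ltr0n.
have gr m w : g m w <= r w.
  by rewrite ler_pdivrMr// truncn_le mulr_ge0.
apply: (@measurable_fun_cvg _ _ _ _ (fun m w => X (g m w) w)); last first.
  move=> w _; apply: (@cvg_comp _ _ _ (g ^~ w) (X ^~ w) _ (nbhs (r w))); last exact: cX.
  apply/cvgrPdist_lt => e e0.
  have [N _ HN] := near_infty_natSinv_lt (PosNum e0).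
  exists N => // m /HN /= me.
  apply: le_lt_trans me; rewrite ger0_norm ?subr_ge0//.
  rewrite -(ler_pM2r (m0 m)) mulrBl divfK ?gt_eqF// mulVf ?gt_eqF// lerBlDl.
  by rewrite ltW// natr1 truncnS_gt.
move=> m _ B mB; rewrite setTI.
rewrite [X in measurable X](_ : _ = \bigcup_i
    ((r @^-1` `[i%:R / m.+1%:R, i.+1%:R / m.+1%:R[%classic) `&`
     (X (i%:R / m.+1%:R) @^-1` B))); last first.
  apply/seteqP; split=> [w /= XB|w [i _ /= [/itvP ri XB]]].
    exists (Num.truncn (r w * m.+1%:R)) => //; split=> //=.
    rewrite in_itv/= gr /= ltr_pdivlMr//; apply: truncnS_gt.
  rewrite /g; have -> // : Num.truncn (r w * m.+1%:R) = i.
  apply: truncn_def; rewrite -ler_pdivrMr// -ltr_pdivlMr//.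
  by rewrite !ri.
apply: bigcupT_measurable => i.
have [[w wi]|Hn] := pselect (exists w,
    `[i%:R / m.+1%:R, i.+1%:R / m.+1%:R[%classic (r w)).
  apply: measurableI; first by rewrite -[_ @^-1` _]setTI; apply: mr.
  rewrite -[_ @^-1` _]setTI; apply: mX => //.
  by exists w; move: wi; rewrite /= in_itv/= => /andP[].
rewrite [X in measurable X](_ : _ = set0) //.
by apply/seteqP; split=> // w [/= H _]; apply: Hn; exists w.
Qed.

(** By continuity the maximum over [0, r] exceeds a if and only if X does so at c r
for some rational c in [0, 1]: rescaling by r makes the countable set of times
depend measurably on the sample. *)
Lemma measurable_running_max X r :
  (forall w, continuous (X ^~ w)) -> (forall w, 0 <= r w) ->
  measurable_fun setT r ->
  (forall s, 0 <= s -> (exists w, s <= r w) -> measurable_fun setT (X s)) ->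
  measurable_fun setT (fun w => running_max (X ^~ w) (r w)).
Proof.
move=> cX r0 mr mX.
(* Truncating q to [0, 1] lets q range over all rationals. *)
pose c (q : R) := Num.max 0 (Num.min q 1).
have c0 q : 0 <= c q by rewrite /c le_max lexx.
have c1 q : c q <= 1 by rewrite /c ge_max ler01 ge_min lexx orbT.
have cc : continuous c.
  move=> q; apply: (@continuous_max R R (cst 0) (id \min cst 1) q).
    exact: cst_continuous.
  by apply: (@continuous_min R R id (cst 1) q); [exact: cvg_id|exact: cst_continuous].
move=> _; apply: (measurability _ (RGenOInfty.measurableE R)) => //.
move=> /= _ [_ [a ->] <-]; rewrite setTI.
rewrite [X in measurable X](_ : _ = \bigcup_(q : rat)
    ((fun w => X (c (ratr q) * r w) w) @^-1` `]a, +oo[%classic)); last first.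
  apply/seteqP; split=> [w /=|w [q _ /=]]; rewrite !in_itv/= !andbT; last first.
    move=> /lt_le_trans; apply; apply: le_running_max => //.
    by rewrite mulr_ge0//= ler_piMl.
  have [s /andP[s0 sr] ->] := running_max_attained (cX w) (r0 w) => aX.
  pose y q := X (c q * r w) w.
  have cy : continuous y.
    move=> q; apply: (@cvg_comp _ _ _ (fun q => c q * r w) (X ^~ w) _
      (nbhs (c q * r w))); last exact: cX.
    by apply: cvgM; [exact: cc|exact: cvg_cst].
  have [_ [/[swap] [[q _ <-]] ay]] : exists z, (y @^-1` [set z | a < z] `&` range ratr) z.
    apply: dense_rat; last by apply: open_comp => //; exact: open_gt.
    exists (s / r w) => /=; rewrite /y.
    have [r00|r_n0] := eqVneq (r w) 0.
      by rewrite r00 mulr0; have -> // : 0 = s; apply/eqP; rewrite eq_le s0 -r00.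
    have rp : 0 < r w by rewrite lt_neqAle eq_sym r_n0 r0.
    by rewrite /c min_l ?ler_pdivrMr ?mul1r// max_r ?divr_ge0// divfK.
  by exists q => //=; rewrite in_itv/= andbT.
apply: bigcupT_measurable_rat => q.
rewrite -[_ @^-1` _]setTI.
apply: (@measurable_eval X (fun w => c (ratr q) * r w)) => //.
- by move=> w; rewrite mulr_ge0.
- by apply: measurable_funM => //; exact: measurable_cst.
- move=> s s0 [w sw]; apply: mX => //; exists w.
  by rewrite (le_trans sw)// ler_piMl.
Qed.

End random_evaluation.

(** * Integrable random variables *)

Section integrals.
Context d (T : measurableType d) (R : realType) (P : probability T R).
Implicit Types (f g : T -> R).

Definition integrable_rv f := P.-integrable setT (EFin \o f).

Lemma integrable_rv_measurable f : integrable_rv f -> measurable_fun setT f.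
Proof. by move=> /measurable_int /measurable_EFinP. Qed.

Lemma bounded_integrable_rv f K : measurable_fun setT f ->
  (forall w, `|f w| <= K) -> integrable_rv f.
Proof.
move=> mf fK; apply: measurable_bounded_integrable => //.
  by rewrite ltey_eq fin_num_measure.
exists K; split; first exact: num_real.
by move=> x Kx w _; apply: (le_trans (fK w)); apply: ltW.
Qed.

Lemma integrable_rvD f g : integrable_rv f -> integrable_rv g ->
  integrable_rv (fun w => f w + g w).
Proof. by move=> fi gi; exact: (integrableD measurableT fi gi). Qed.

Lemma integrable_rvB f g : integrable_rv f -> integrable_rv g ->
  integrable_rv (fun w => f w - g w).
Proof. by move=> fi gi; exact: (integrableB measurableT fi gi). Qed.

Lemma integrable_rvZ k f : integrable_rv f -> integrable_rv (fun w => k * f w).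
Proof. by move=> fi; exact: (integrableZl measurableT k fi). Qed.

Lemma integrable_rv_indic E f : measurable E -> integrable_rv f ->
  integrable_rv (fun w => \1_E w * f w).
Proof.
move=> mE fi; have mf := integrable_rv_measurable fi.
apply: le_integrable fi => //.
  apply/measurable_EFinP; apply: measurable_funM => //; exact: measurable_indic.
move=> w _ /=; rewrite lee_fin normrM indicE ler_piMl//.
by case: (w \in E); rewrite ?normr1 ?normr0.
Qed.

Lemma Rintegral_indic E f : \int[P]_w (\1_E w * f w) = \int[P]_(w in E) f w.
Proof.
rewrite [RHS]Rintegral_mkcond; apply: eq_Rintegral => w _.
by rewrite patchE indicE; case: ifPn => wE; rewrite ?mul1r ?mul0r.
Qed.

Lemma integrable_bool (e : T -> bool) : measurable_fun setT e ->
  integrable_rv (fun w => (e w)%:R).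
Proof.
move=> me; apply: (@bounded_integrable_rv _ 1) => [|w].
  rewrite (_ : (fun w => _) = \1_[set w | e w]).
    apply: measurable_indic; rewrite -[X in measurable X]setTI.
    exact: (me measurableT [set true]).
  apply/funext => w; rewrite indicE; congr (_%:R).
  by congr nat_of_bool; apply/idP/idP; rewrite inE.
by case: (e w); rewrite ?normr1 ?normr0.
Qed.

Lemma integrable_rv_sum n (f : 'I_n -> T -> R) : (forall i, integrable_rv (f i)) ->
  integrable_rv (fun w => \sum_(i < n) f i w).
Proof.
move=> fi; rewrite /integrable_rv.
have -> : EFin \o (fun w => \sum_(i < n) f i w) = fun w => (\sum_(i < n) (f i w)%:E)%E.
  by apply/funext => w; rewrite /= sumEFin.
by apply: integrable_sum => // i _; exact: fi.
Qed.

Lemma Rintegral_sum n (f : 'I_n -> T -> R) : (forall i, integrable_rv (f i)) ->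
  \int[P]_w (\sum_(i < n) f i w) = \sum_(i < n) \int[P]_w f i w.
Proof.
move=> fi; rewrite /Rintegral.
under eq_integral do rewrite -sumEFin.
rewrite integral_sum//; rewrite sum_fine // => i _.
exact: (integrable_fin_num measurableT (fi i)).
Qed.

Lemma Rintegral_cvg (f_ : nat -> T -> R) f g :
  (forall n, measurable_fun setT (f_ n)) -> measurable_fun setT f ->
  integrable_rv g -> (forall n w, `|f_ n w| <= g w) ->
  {ae P, forall w, f_ ^~ w @ \oo --> f w} ->
  \int[P]_w f_ n w @[n --> \oo] --> \int[P]_w f w.
Proof.
move=> mf_ mf gi fg fcv; apply: fine_cvg.
have [| | | |fi _ H] := @dominated_convergence _ _ _ P setT measurableT
   (fun n w => (f_ n w)%:E) (EFin \o f) (EFin \o g) _ _ _ gi _.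
- by move=> n; apply/measurable_EFinP.
- by apply/measurable_EFinP.
- by apply: filterS fcv => w fw _; apply: cvg_EFin => /=; [exact: nearW|exact: fw].
- by apply: aeW => w n _; rewrite lee_fin.
- by rewrite fineK //; apply: integrable_fin_num.
Qed.

Lemma Rintegral_cvg0 (f_ : nat -> T -> R) f g :
  (forall n, measurable_fun setT (f_ n)) -> measurable_fun setT f ->
  integrable_rv g -> (forall n w, `|f_ n w| <= g w) ->
  {ae P, forall w, f_ ^~ w @ \oo --> f w} ->
  (forall n, \int[P]_w f_ n w = 0) -> \int[P]_w f w = 0.
Proof.
move=> mf_ mf gi fg fcv f0; have := Rintegral_cvg mf_ mf gi fg fcv.
under eq_fun do rewrite f0.
by move=> /cvg_lim <- //; rewrite lim_cst.
Qed.

End integrals.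

(** * Adapted processes and stopping times *)

Section sub_sigma_algebra.
Context d (T : measurableType d) (R : realType).
Variable G : set (set T).
Hypothesis sG : sigma_algebra setT G.

(** Measurability with respect to G is measurability on the measurable space
that G generates, so that the lemmas on measurable functions apply to it. *)
Lemma measurable_wrtP (Y : T -> R) : measurable_wrt G Y <->
  measurable_fun (setT : set (g_sigma_algebraType G)) (Y : g_sigma_algebraType G -> R).
Proof.
split=> [mY _ B mB|mY B mB].
  by rewrite setTI measurable_g_measurableTypeE//; apply: mY.
have := mY measurableT B mB.
by rewrite setTI measurable_g_measurableTypeE.
Qed.

Lemma sub_setI A B : G A -> G B -> G (A `&` B).
Proof.
rewrite -{1 2 3}(measurable_g_measurableTypeE sG) => GA GB.
exact: (@measurableI _ (g_sigma_algebraType G)).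
Qed.

End sub_sigma_algebra.

Section adapted_processes.
Context d (T : measurableType d) (R : realType) (F : R -> set (set T)).
Hypothesis hF : filtration F.
Implicit Types (X Y : R -> T -> R) (S : T -> \bar R).

Lemma filtration_sigma t : 0 <= t -> sigma_algebra setT (F t).
Proof. by case: hF => + _ _; apply. Qed.

Lemma filtration_measurable t A : 0 <= t -> F t A -> measurable A.
Proof. by case: hF => _ + _ => /[apply]; apply. Qed.

Lemma filtration_le s t A : 0 <= s -> s <= t -> F s A -> F t A.
Proof. by case: hF => _ _ + s0 st; apply. Qed.

Lemma measurable_wrt_le s t f : 0 <= s -> s <= t ->
  measurable_wrt (R := R) (F s) f -> measurable_wrt (F t) f.
Proof. by move=> s0 st mf B mB; apply: filtration_le st _ => //; apply: mf. Qed.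

Lemma adapted_measurable X t : adapted F X -> 0 <= t -> measurable_fun setT (X t).
Proof.
move=> aX t0 _ B mB; rewrite setTI.
by apply: (filtration_measurable t0); apply: aX.
Qed.

(** S may be measurable only with respect to the whole filtration, but t /\ S
is determined by the past of t. *)
Lemma until_adapted S t : stopping_time F S -> 0 <= t ->
  measurable_wrt (F t) (fun w => until t (S w)).
Proof.
move=> [S0 FS] t0; have sF := filtration_sigma t0.
apply/(measurable_wrtP sF) => _.
apply: (measurability _ (RGenOInfty.measurableE R)) => // _ /= [_ [a ->] <-].
rewrite setTI measurable_g_measurableTypeE//.
have [ta|at_] := leP t a.
  rewrite [X in F t X](_ : _ = set0); first by case: sF.
  apply/seteqP; split => // w /=; rewrite in_itv/= andbT => aS.
  have /andP[_] := until_itv t0 (S0 w).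
  by move=> /(lt_le_trans aS)/(le_lt_trans ta); rewrite ltxx.
have [a0|a0] := leP 0 a; last first.
  rewrite [X in F t X](_ : _ = setT).
    by rewrite -[setT]setD0; case: sF => s0 sD _; apply: sD.
  apply/seteqP; split => // w _ /=; rewrite in_itv/= andbT.
  by apply: (lt_le_trans a0); have /andP[] := until_itv t0 (S0 w).
rewrite [X in F t X](_ : _ = setT `\` [set w | (S w <= a%:E)%E]).
  case: sF => _ sD _; apply: sD; apply: (filtration_le a0 (ltW at_)); exact: FS.
apply/seteqP; split=> w /=; rewrite in_itv/= andbT.
  move=> aS; split=> // Sa.
  by have := le_trans (until_le t0 (S0 w)) Sa; rewrite lee_fin leNgt aS.
move=> [_ /negP]; rewrite -ltNge => aS.
rewrite /until; case: (S w) aS (S0 w) => [s| |]//.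
  by rewrite lte_fin -EFin_min/= lt_min at_.
by rewrite miney.
Qed.

Lemma stopped_adapted X S : adapted F X -> (forall w, continuous (X ^~ w)) ->
  stopping_time F S -> adapted F (stopped X S).
Proof.
move=> aX cX hS t t0; have sF := filtration_sigma t0.
have [S0 _] := hS; have U w := until_itv t0 (S0 w).
apply/(measurable_wrtP sF).
apply: (@measurable_eval _ _ (g_sigma_algebraType (F t)) X
  (fun w => until t (S w))) => //.
- by move=> w; case/andP: (U w).
- by apply/(measurable_wrtP sF); apply: until_adapted.
- move=> s s0 [w sw]; apply/(measurable_wrtP sF).
  apply: measurable_wrt_le s0 _ (aX _ s0).
  by rewrite (le_trans sw)//; case/andP: (U w).
Qed.

Lemma hit_stopping_time X a : adapted F X -> (forall w, continuous (X ^~ w)) ->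
  stopping_time F (fun w => hit (X ^~ w) a).
Proof.
move=> aX cX; split=> [w|t t0]; first exact: hit_ge0.
have sF := filtration_sigma t0.
rewrite [X in F t X](_ : _ = (fun w => running_max (X ^~ w) t) @^-1` `[a, +oo[%classic).
  suff : measurable_wrt (F t) (fun w => running_max (X ^~ w) t) by apply.
  apply/(measurable_wrtP sF).
  apply: (@measurable_running_max _ _ (g_sigma_algebraType (F t)) X (cst t)) => //.
  move=> s s0 [w /= st]; apply/(measurable_wrtP sF).
  exact: measurable_wrt_le s0 st (aX _ s0).
apply/seteqP; split=> w /=; by rewrite hit_le// in_itv/= andbT.
Qed.

Lemma min_stopping_time S S' : stopping_time F S -> stopping_time F S' ->
  stopping_time F (fun w => Order.min (S w) (S' w)).
Proof.
move=> [S0 hS] [S'0 hS']; split=> [w|t t0]; first by rewrite le_min S0 S'0.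
have sF := filtration_sigma t0.
rewrite [X in F t X](_ : _ = [set w | (S w <= t%:E)%E] `|` [set w | (S' w <= t%:E)%E]).
  rewrite -(measurable_g_measurableTypeE sF).
  apply: (@measurableU _ (g_sigma_algebraType (F t)));
    rewrite measurable_g_measurableTypeE//.
  - exact: hS.
  - exact: hS'.
by apply/seteqP; split=> w /=; rewrite ge_min => /orP.
Qed.

Lemma adaptedM X Y : adapted F X -> adapted F Y -> adapted F (fun t w => X t w * Y t w).
Proof.
move=> aX aY t t0; have sF := filtration_sigma t0; apply/(measurable_wrtP sF).
by apply: measurable_funM; apply/(measurable_wrtP sF); [exact: aX|exact: aY].
Qed.

Lemma adapted_comp X (f : R -> R) : measurable_fun setT f ->
  adapted F X -> adapted F (fun t w => f (X t w)).
Proof.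
move=> mf aX t t0 B mB; rewrite -[_ @^-1` _]/(X t @^-1` (f @^-1` B)).
by apply: aX => //; rewrite -[X in measurable X]setTI; apply: mf.
Qed.

Lemma adapted_cst (f : T -> R) : measurable_wrt (F 0) f -> adapted F (fun _ => f).
Proof. by move=> mf t t0; apply: measurable_wrt_le mf. Qed.

End adapted_processes.

(** * Optional stopping for continuous martingales *)

Section optional_stopping.
Context d (T : measurableType d) (R : realType) (P : probability T R).
Context (F : R -> set (set T)).
Hypothesis hF : filtration F.
Implicit Types (X Z : R -> T -> R) (S : T -> \bar R).

Lemma martingale_increment X s t B : martingale P F X -> 0 <= s -> s <= t ->
  F s B -> \int[P]_w (\1_B w * (X t w - X s w)) = 0.
Proof.
move=> [aX iX cX] s0 st FB; have t0 := le_trans s0 st.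
have mB := filtration_measurable hF s0 FB.
have iXs : integrable_rv P (X s) by apply: iX.
have iXt : integrable_rv P (X t) by apply: iX.
rewrite Rintegral_indic RintegralB//; last 2 first.
- exact: integrableS iXt.
- exact: integrableS iXs.
have [_ _ /(_ B FB)] := cX s t s0 st.
by rewrite /Rintegral => ->; rewrite subrr.
Qed.

Lemma martingale_of_increments X : adapted F X ->
  (forall t, 0 <= t -> integrable_rv P (X t)) ->
  (forall s t B, 0 <= s -> s <= t -> F s B ->
    \int[P]_w (\1_B w * (X t w - X s w)) = 0) ->
  martingale P F X.
Proof.
move=> aX iX dX; split=> // s t s0 st; have t0 := le_trans s0 st.
split; [exact: aX|exact: iX|move=> B FB].
have mB := filtration_measurable hF s0 FB.
have iXs : P.-integrable B (EFin \o X s) by apply: integrableS (iX _ s0).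
have iXt : P.-integrable B (EFin \o X t) by apply: integrableS (iX _ t0).
have := dX s t B s0 st FB; rewrite Rintegral_indic RintegralB//.
move=> /subr0_eq XE; have := congr1 (@EFin R) XE.
by rewrite /Rintegral !fineK => [->||]//; apply: integrable_fin_num.
Qed.

Section stopping.
Variables (Z : R -> T -> R) (S : T -> \bar R) (K : R).
Hypothesis mZ : martingale P F Z.
Hypothesis cZ : forall w, continuous (Z ^~ w).
Hypothesis hS : stopping_time F S.
Hypothesis K0 : 0 < K.
Hypothesis ZK : forall t w, 0 <= t -> `|Z (until t (S w)) w| <= K.

Let aZ : adapted F Z. Proof. by have [] := mZ. Qed.

Let S0 w : (0 <= S w)%E. Proof. by have [] := hS. Qed.

(** The increment of Z from S to t, on the event s <= S < t, is approximated by
rounding S up to a grid that cuts [s, t[ into k + 1 intervals: the rounded time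
takes finitely many values, and the martingale property applies at each. *)
Section grid.
Variables (s t : R) (D : set T).
Hypotheses (s0 : 0 <= s) (st : s < t) (FD : F s D).

Let t0 : 0 <= t := le_trans s0 (ltW st).
Let U w := until t (S w).
Let b (k i : nat) := s + (t - s) * (i%:R / k.+1%:R).
Let E k i := [set w | [/\ D w, b k i <= U w < b k i.+1 &
  `|Z (b k i.+1) w| <= 2 * K]].
Let f k w := \sum_(i < k.+1) (\1_(E k i) w * (Z t w - Z (b k i.+1) w)).
Let J := [set w | s <= U w < t].

Let ts : 0 < t - s. Proof. by rewrite subr_gt0. Qed.
Let k0 (k : nat) : 0 < k.+1%:R :> R. Proof. by rewrite ltr0n. Qed.

Let b_ge k i : s <= b k i.
Proof. by rewrite lerDl mulr_ge0 ?divr_ge0// ltW. Qed.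

Let b_le k i : (i <= k.+1)%N -> b k i <= t.
Proof.
move=> ik; rewrite -lerBrDl ger_pMr// ler_pdivrMr// mul1r.
by rewrite ler_nat.
Qed.

Let FE k i : (i < k.+1)%N -> F (b k i.+1) (E k i).
Proof.
move=> ik; have c0 : 0 <= b k i.+1 by apply: le_trans s0 (b_ge _ _).
have sF := filtration_sigma hF c0.
rewrite (_ : E k i = D `&`
   ((fun w => until (b k i.+1) (S w)) @^-1` `[b k i, b k i.+1[%classic
   `&` (Z (b k i.+1) @^-1` `[- (2 * K), 2 * K]%classic))).
  apply: (sub_setI sF); first by apply: (filtration_le hF s0) FD; exact: b_ge.
  apply: (sub_setI sF).
    by have := until_adapted hF hS c0; apply.
  by apply: aZ.
have ct := b_le ik.
have UE w : until (b k i.+1) (S w) = Num.min (b k i.+1) (U w).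
  by rewrite /U /until; case: (S w) (S0 w) => [u| |]// _;
    rewrite ?miney -?EFin_min /= ?minA ?(min_l ct).
apply/seteqP; split => w /=; rewrite !in_itv/= UE -ler_norml.
  by move=> [Dw /andP[bU Uc] ZU]; rewrite (min_r (ltW Uc)) bU Uc.
move=> [Dw [/andP[bU Uc] ZU]]; split => //.
by move: bU Uc; rewrite le_min gt_min ltxx => /andP[_ ->].
Qed.

Let idx k w : nat := Num.truncn ((U w - s) / (t - s) * k.+1%:R).

Let idx_eq k i w : s <= U w -> (b k i <= U w < b k i.+1) = (i == idx k w).
Proof.
move=> sU; have -> : (b k i <= U w < b k i.+1) =
    (i%:R <= (U w - s) / (t - s) * k.+1%:R < i.+1%:R).
  rewrite /b -lerBrDl -ltrBlDl -ler_pdivlMl// -ltr_pdivrMl//.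
  by rewrite ler_pdivrMr// ltr_pdivlMr// ![_^-1 * _]mulrC.
apply/idP/eqP => [/truncn_def//|->]; apply: truncn_itv.
by rewrite mulr_ge0// divr_ge0// ?subr_ge0// ltW.
Qed.

Let idx_lt k w : J w -> (idx k w < k.+1)%N.
Proof.
move=> /andP[sU Ut]; rewrite /idx -(ltr_nat R).
have := @truncn_le R ((U w - s) / (t - s) * k.+1%:R).
rewrite mulr_ge0 ?divr_ge0 ?subr_ge0 ?(ltW st)// => /le_lt_trans; apply.
by rewrite gtr_pMl// ltr_pdivrMr// mul1r ltrD2r.
Qed.

Let fE k w : f k w = if (w \in D `&` J) && (`|Z (b k (idx k w).+1) w| <= 2 * K)
  then Z t w - Z (b k (idx k w).+1) w else 0.
Proof.
case: ifPn => [/andP[]|].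
  rewrite inE => -[Dw Jw] Zw; have il := idx_lt k Jw.
  rewrite /f (bigD1 (Ordinal il))//= big1 ?addr0 => [|i ii].
    rewrite indicE mem_set ?mul1r//; split => //.
    by rewrite idx_eq//; case/andP: Jw.
  rewrite indicE memNset ?mul0r// => -[_ + _].
  rewrite idx_eq; last by case/andP: Jw.
  by move=> /eqP iE; move: ii => /eqP; apply; apply/val_inj.
move=> H; rewrite /f big1// => i _; rewrite indicE memNset ?mul0r// => -[Dw Uw Zw].
have /andP[Ub Uc] := Uw.
have sU : s <= U w by apply: le_trans Ub.
have Ut : U w < t by apply: lt_le_trans Uc (b_le _).
move: Uw; rewrite idx_eq// => /eqP iE; rewrite iE in Zw.
move/negP: H; apply; rewrite Zw andbT; apply/mem_set; split=> //.
by rewrite /J /= sU.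
Qed.

Let mZt u : 0 <= u -> measurable_fun setT (Z u).
Proof. exact: (adapted_measurable hF aZ). Qed.

Let iZ u : 0 <= u -> integrable_rv P (Z u).
Proof. by have [_ + _] := mZ; apply. Qed.

Let ibit k i : (i < k.+1)%N ->
  integrable_rv P (fun w => \1_(E k i) w * (Z t w - Z (b k i.+1) w)).
Proof.
move=> ik; have c0 : 0 <= b k i.+1 by apply: le_trans s0 (b_ge _ _).
apply: integrable_rv_indic; first exact: (filtration_measurable hF c0 (FE ik)).
by apply: integrable_rvB; apply: iZ.
Qed.

Let int_f k : \int[P]_w f k w = 0.
Proof.
rewrite Rintegral_sum; last by move=> i; apply: ibit.
apply: big1 => i _; apply: martingale_increment => //.
- by apply: le_trans s0 (b_ge _ _).
- exact: b_le.
- exact: FE.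
Qed.

Let mU : measurable_fun setT U.
Proof.
move=> _ B mB; rewrite setTI; apply: (filtration_measurable hF t0).
by have := until_adapted hF hS t0; apply.
Qed.

Let mJ : measurable J.
Proof. by rewrite -[J]setTI; apply: (mU measurableT (measurable_itv `[s, t[)). Qed.

Let mZU : measurable_fun setT (fun w => Z (U w) w).
Proof. exact: (adapted_measurable hF (stopped_adapted hF aZ cZ hS) t0). Qed.

Let bcvg w : J w -> b k (idx k w).+1 @[k --> \oo] --> U w.
Proof.
move=> Jw; apply/cvgrPdist_lt => e e0.
have [N _ HN] := near_infty_natSinv_lt (PosNum (divr_gt0 e0 ts)).
exists N => // k /HN /= ke; move: (ke); rewrite ltr_pdivlMr// mulrC => {}ke.
have := @idx_eq k (idx k w) w; rewrite eqxx.
have /andP[sU Ut] := Jw => /(_ sU) /andP[bU Ub].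
rewrite ltr0_norm ?subr_lt0// opprB; apply: le_lt_trans ke.
suff -> : b k (idx k w).+1 = b k (idx k w) + (t - s) / k.+1%:R.
  by rewrite addrAC gerDr subr_le0.
have H (n : nat) : n.+1%:R / k.+1%:R = n%:R / k.+1%:R + k.+1%:R^-1 :> R.
  by rewrite -natr1 mulrDl mul1r.
by rewrite /b H mulrDr addrA.
Qed.

(** On E k i, an event of the past of the right end point b k i.+1, the
increment of Z from b k i.+1 to t has mean 0; then k goes to infinity.
Uniform integrability of the values of Z on the grid is not an issue: the
values above 2 K are cut off by an event that is known at the time of the cut,
which does not affect the means, and in the limit nothing is cut off since
|Z_S| <= K < 2 K. *)
Lemma grid_increment : \int[P]_w (\1_(D `&` J) w * (Z t w - Z (U w) w)) = 0.
Proof.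
have mD := filtration_measurable hF s0 FD.
apply: (@Rintegral_cvg0 _ _ _ _ f _ (fun w => `|Z t w| + 2 * K)).
- move=> k; rewrite /f; apply: measurable_sum => i.
  by apply: integrable_rv_measurable (ibit _).
- apply: measurable_funM; first by apply: measurable_indic; apply: measurableI.
  by apply: measurable_funB => //; exact: mZt.
- apply: integrable_rvD; first by apply: integrable_norm; apply: iZ.
  exact: finite_measure_integrable_cst.
- move=> k w; rewrite fE; case: ifPn => [/andP[_ ZK2]|_].
    by apply: le_trans (ler_normB _ _) _; rewrite lerD2l.
  by rewrite normr0 addr_ge0// mulr_ge0// ltW.
- apply: aeW => w; have [DJw|DJw] := pselect ((D `&` J) w); last first.
    rewrite indicE memNset// mul0r; under eq_fun do rewrite fE memNset//.
    exact: cvg_cst.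
  rewrite indicE mem_set// mul1r.
  have [_ Jw] := DJw.
  have Zc : Z (b k (idx k w).+1) w @[k --> \oo] --> Z (U w) w.
    by apply: (@cvg_comp _ _ _ _ (Z ^~ w) _ (nbhs (U w)) _ (bcvg Jw)); exact: cZ.
  have : Z t w - Z (b k (idx k w).+1) w @[k --> \oo] --> Z t w - Z (U w) w.
    by apply: cvgB Zc; exact: cvg_cst.
  apply: cvg_trans; apply: near_eq_cvg; near=> k.
  rewrite fE mem_set//= ifT//.
  apply/ltW; near: k.
  have ZU : `|Z (U w) w| < 2 * K.
    by apply: (le_lt_trans (ZK w t0)); rewrite mulr_natl mulr2n ltrDl.
  exact: (cvgr_lt _ (cvg_norm Zc) _ ZU).
- exact: int_f.
Unshelve. all: by end_near. Qed.

End grid.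

(** If S < s, both terms agree. Otherwise the increment of the stopped process
is Z_t - Z_s, minus Z_t - Z_S when S < t, and both have mean 0. *)
Lemma stopped_increment s t B : 0 <= s -> s <= t -> F s B ->
  \int[P]_w (\1_B w * (Z (until t (S w)) w - Z (until s (S w)) w)) = 0.
Proof.
move=> s0; rewrite le_eqVlt => /predU1P[<- _|st FB].
  under eq_Rintegral do rewrite subrr mulr0.
  by rewrite Rintegral_cst// mul0r.
have t0 := le_trans s0 (ltW st); have sF := filtration_sigma hF s0.
pose D := B `&` (fun w => until s (S w)) @^-1` `[s, +oo[%classic.
have FD : F s D.
  by apply: (sub_setI sF) => //; have := until_adapted hF hS s0; apply.
have mD := filtration_measurable hF s0 FD.
pose J := [set w | s <= until t (S w) < t].
have mJ : measurable J.
  apply: (filtration_measurable hF t0).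
  by have := until_adapted hF hS t0 (measurable_itv `[s, t[); rewrite /preimage /=.
have iZ u : 0 <= u -> integrable_rv P (Z u) by have [_ + _] := mZ; apply.
have mZU : measurable_fun setT (fun w => Z (until t (S w)) w).
  exact: (adapted_measurable hF (stopped_adapted hF aZ cZ hS) t0).
transitivity (\int[P]_w (\1_D w * (Z t w - Z s w) -
   \1_(D `&` J) w * (Z t w - Z (until t (S w)) w))).
  apply: eq_Rintegral => w _; rewrite !indicE.
  rewrite !in_setI.
  have [Bw|Bw] := boolP (w \in B); rewrite ?mul0r ?subrr// mul1r/=.
  have -> : (w \in (fun w => until s (S w)) @^-1` `[s, +oo[%classic) = (s%:E <= S w)%E.
    apply/idP/idP; rewrite inE /= in_itv/= andbT.
      by move=> sU; apply: le_trans (until_le s0 (S0 w)); rewrite lee_fin.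
    by move=> sS; rewrite until_id.
  have [sS|Ss] := leP s%:E (S w).
    rewrite mul1r (until_id sS).
    have [/set_mem/andP[sU Ut]|] := boolP (w \in J).
      by rewrite mul1r; ring.
    move=> /negP; rewrite inE => /negP; rewrite negb_and -!ltNge -leNgt.
    move=> H; have -> : until t (S w) = t.
      move: H sS; rewrite /until; case: (S w) (S0 w) => [u| |]// u0.
        rewrite lee_fin -EFin_min/= => + su.
        case: (leP t u) => // tu /orP[us|tu2].
          by have := lt_le_trans us su; rewrite ltxx.
        by have := lt_le_trans tu tu2; rewrite ltxx.
      by rewrite miney.
    by rewrite mul0r subr0.
  rewrite !mul0r subr0; case: (S w) Ss (S0 w) => [u| |]//; rewrite lte_fin => us _.
  by rewrite !until_fin ?subrr// ltW// (lt_trans us).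
rewrite RintegralB//.
- by rewrite (martingale_increment mZ)// ?(ltW st)// grid_increment// subrr.
- by apply: integrable_rv_indic => //; apply: integrable_rvB; exact: iZ.
- apply: integrable_rv_indic; first exact: measurableI.
  apply: integrable_rvB; first exact: iZ.
  by apply: (@bounded_integrable_rv _ _ _ _ _ K) => // w; exact: ZK.
Qed.

End stopping.
End optional_stopping.

(** * Bounded stopped local martingales at a pseudo-stopping time *)

Lemma continuous_max0 (R : realType) (x : R -> R) :
  continuous_path x -> continuous (fun t : R => x (Num.max t 0)).
Proof.
move=> /subspace_continuousP cx t.
have cm : {for t, continuous (fun u : R => Num.max u 0)}.
  by apply: (@continuous_max R R id (cst 0) t); [exact: cvg_id|exact: cst_continuous].
apply: (@cvg_comp _ _ _ (fun u : R => Num.max u 0) x (nbhs t)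
   (within `[0, +oo[%classic (nbhs (Num.max t 0)))).
  move=> B wB.
  have : nbhs t [set u : R | `[0, +oo[%classic (Num.max u 0) -> B (Num.max u 0)].
    exact: (cm _ wB).
  apply: filterS => u; apply.
  by rewrite /= in_itv/= andbT le_max lexx orbT.
by apply: cx; rewrite /= in_itv/= andbT le_max lexx orbT.
Qed.

Lemma continuous_until (R : realType) (S : \bar R) : (0 <= S)%E ->
  continuous (until ^~ S).
Proof.
case: S => [s| |] // s0.
  have -> : until ^~ s%:E = (id \min cst s).
    by apply/funext => u; rewrite /until -EFin_min.
  by move=> t; apply: (@continuous_min R R id (cst s) t);
    [exact: cvg_id|exact: cst_continuous].
have -> : until ^~ +oo%E = @id R by apply/funext => u; rewrite /until miney.
by move=> t; exact: cvg_id.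
Qed.

Section local_martingales.
Context d (T : measurableType d) (R : realType) (P : probability T R).
Context (F : R -> set (set T)).
Hypothesis hF : filtration F.
Implicit Types (X M A : R -> T -> R) (S rho : T -> \bar R).

(** Good paths everywhere rather than almost everywhere: exit times and evaluations
can then be handled path by path without exceptional sets. *)
Definition regular_local_martingale X :=
  [/\ adapted F X, forall w, continuous (X ^~ w), forall w, X 0 w = 0 &
    exists2 tau, localizing_sequence P F tau &
      forall n, martingale P F (stopped X (tau n))].

(** Stopping at S commutes with stopping at a localizing time, so that optional
stopping applies to the localized martingale, with the bound K at hand; the
localization is then removed by dominated convergence. *)
Lemma bounded_stopped_martingale X S K : regular_local_martingale X ->
  stopping_time F S -> (forall t w, 0 <= t -> `|stopped X S t w| <= K) ->
  martingale P F (stopped X S).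
Proof.
move=> [aX cX X0 [tau [htau _ tauy] mtau]] hS XK.
have aS := stopped_adapted hF aX cX hS.
have [S0 _] := hS.
have mX t : 0 <= t -> measurable_fun setT (stopped X S t).
  exact: (adapted_measurable hF aS).
have XK1 t w : 0 <= t -> `|stopped X S t w| <= Num.max K 1.
  by move=> t0; rewrite le_max XK.
apply: (martingale_of_increments hF) => // [t t0|s t B s0 st FB].
  by apply: (@bounded_integrable_rv _ _ _ _ _ K) => [|w]; [exact: mX|exact: XK].
have t0 := le_trans s0 st.
have mB := filtration_measurable hF s0 FB.
pose Z n := stopped X (tau n).
have tau0 n w : (0 <= tau n w)%E by have [] := htau n.
have ZX n u w : 0 <= u ->
    Z n (until u (S w)) w = stopped X S (until u (tau n w)) w.
  move=> u0; rewrite /Z -[LHS]/(X (until _ (tau n w)) w) -untilA//.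
  by rewrite minC untilA.
have ZK n u w : 0 <= u -> `|Z n (until u (S w)) w| <= Num.max K 1.
  by move=> u0; rewrite ZX// XK1//; case/andP: (until_itv u0 (tau0 n w)).
have cZ n w : continuous (Z n ^~ w).
  move=> u; apply: (@cvg_comp _ _ _ (fun u => until u (tau n w)) (X ^~ w) _
    (nbhs (until u (tau n w)))); first exact: continuous_until.
  exact: cX.
have mZU n u : 0 <= u -> measurable_fun setT (fun w => Z n (until u (S w)) w).
  move=> u0; have [aZ _ _] := mtau n.
  exact: (adapted_measurable hF (stopped_adapted hF aZ (cZ n) hS) u0).
apply: (@Rintegral_cvg0 _ _ _ _
   (fun n w => \1_B w * (Z n (until t (S w)) w - Z n (until s (S w)) w)) _
   (cst (2 * Num.max K 1))).
- move=> n; apply: measurable_funM; first exact: measurable_indic.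
  by apply: measurable_funB; exact: mZU.
- apply: measurable_funM; first exact: measurable_indic.
  by apply: measurable_funB; exact: mX.
- exact: finite_measure_integrable_cst.
- move=> n w; rewrite normrM -[leRHS]mul1r ler_pM//.
    by rewrite indicE; case: (w \in B); rewrite ?normr1 ?normr0.
  apply: (le_trans (ler_normB _ _)); rewrite mulr_natl mulr2n.
  by apply: lerD; exact: ZK.
- move: tauy; apply: filterS => w /cvgeyPge /(_ t) tw.
  apply: cvg_near_cst.
  apply: filterS tw => n tn.
  rewrite !ZX// (until_id tn) until_id//.
  by rewrite (le_trans _ tn)// lee_fin.
- move=> n.
  apply: (stopped_increment hF (mtau n) (cZ n) hS (K := Num.max K 1)) => //;
    last exact: ZK.
  by rewrite lt_max ltr01 orbT.
Qed.

Definition at_exit X rho S w : R := X (until (fine (rho w)) (S w)) w.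

Section completeness.
Hypothesis cF : complete_filtration P F.

Lemma negligible_measurable N : P.-negligible N -> measurable N.
Proof. by move=> /cF; apply: (filtration_measurable hF). Qed.

(** The value of a process at a random time is unspecified where this time is
infinite. Completeness of the filtration makes changes on such a null event
harmless for measurability. *)
Lemma ae_eq_measurable (f g : T -> \bar R) :
  measurable_fun setT g -> {ae P, forall w, f w = g w} -> measurable_fun setT f.
Proof.
move=> mg fg _ B mB; rewrite setTI.
have mN := negligible_measurable fg.
rewrite (_ : f @^-1` B = (g @^-1` B `\` ~` [set w | f w = g w]) `|`
   (f @^-1` B `&` ~` [set w | f w = g w])).
  apply: measurableU.
    by apply: measurableD => //; rewrite -[_ @^-1` _]setTI; apply: mg.
  by apply: negligible_measurable; apply: negligibleS fg; exact: subIsetr.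
apply/seteqP; split => w /=.
  move=> fB; have [e|ne] := pselect (f w = g w); last by right.
  by left; rewrite -e; split.
by move=> [[gB /contrapT ->]|[]].
Qed.

Lemma ae_eq_integral_complete (f g : T -> \bar R) :
  measurable_fun setT g -> {ae P, forall w, f w = g w} ->
  (\int[P]_w f w = \int[P]_w g w)%E.
Proof.
move=> mg fg; apply: ae_eq_integral => //; first exact: ae_eq_measurable fg.
by apply: filterS fg.
Qed.

(** The only use of the pseudo-stopping property: it is applied to X stopped
at S, a bounded continuous martingale that starts from 0. *)
Lemma pseudo_stopped_mean X S K rho : regular_local_martingale X ->
  stopping_time F S -> (forall t w, 0 <= t -> `|stopped X S t w| <= K) ->
  pseudo_stopping_time P F rho -> P [set w | rho w = +oo%E] = 0%E ->
  \int[P]_w at_exit X rho S w = 0.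
Proof.
move=> rX hS XK [[mrho rho0] hrho] rhoy.
have mX := bounded_stopped_martingale rX hS XK.
have [aX cX X0 _] := rX.
have [S0 _] := hS.
have cXS w : continuous (stopped X S ^~ w).
  move=> u; apply: (@cvg_comp _ _ _ (fun u => until u (S w)) (X ^~ w) _
    (nbhs (until u (S w)))); first exact: continuous_until.
  exact: cX.
have r0 w : 0 <= fine (rho w) by rewrite fine_ge0.
have mr : measurable_fun setT (fun w => fine (rho w)).
  by apply: measurableT_comp => //; exact: fine_measurable.
have aXS := stopped_adapted hF aX cX hS.
have mXr : measurable_fun setT (fun w => X (until (fine (rho w)) (S w)) w).
  apply: (@measurable_eval _ _ _ (stopped X S)) => // s s0 _.
  exact: (adapted_measurable hF aXS).
have := hrho _ mX _ _.
have -> : (\int[P]_w at_time (stopped X S) rho w =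
    \int[P]_w (X (until (fine (rho w)) (S w)) w)%:E)%E.
  apply: ae_eq_integral_complete; first exact/measurable_EFinP.
  exists [set w | rho w = +oo%E]; split => //.
    rewrite -[X in measurable X]setTI.
    exact: (mrho measurableT [set +oo%E] (emeasurable_set1 _)).
  move=> w /= H; apply: contrapT => rw; apply: H.
  by rewrite /at_time; case: (rho w) (rho0 w) rw => // r _.
rewrite /Rintegral => ->.
- rewrite unlock (_ : (fun w => _) = cst 0%E); last first.
    by apply/funext => w /=; rewrite /stopped min_l// X0.
  by rewrite integral_cst// mul0e.
- by exists K.
- apply: aeW => w; split=> t t0; first by apply: cvg_at_right_filter; exact: cXS.
  by apply/cvg_ex; exists (stopped X S t w); apply: cvg_at_left_filter; exact: cXS.
Qed.

End completeness.

Lemma adapted_indic Om : F 0 Om -> adapted F (fun _ => \1_Om : T -> R).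
Proof.
move=> FO; have sF := filtration_sigma hF (lexx 0).
apply: (adapted_cst hF); apply/(measurable_wrtP sF); apply: measurable_indic.
by rewrite measurable_g_measurableTypeE.
Qed.

(** Om is meant to be an almost sure event on which X has good paths. *)
Definition regularized Om X t w : R := \1_Om w * X (Num.max t 0) w.

Lemma regularized_adapted X Om : F 0 Om -> adapted F X ->
  adapted F (regularized Om X).
Proof.
move=> FO aX; apply: (adaptedM hF); first exact: adapted_indic.
by move=> t t0; rewrite max_l//; exact: aX.
Qed.

Lemma regularized_continuous X Om w : (Om w -> continuous_path (X ^~ w)) ->
  continuous (regularized Om X ^~ w).
Proof.
rewrite /regularized => cX; have [Ow|Ow] := pselect (Om w).
  by under eq_fun do rewrite indicE mem_set// mul1r; exact: (continuous_max0 (cX Ow)).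
by under eq_fun do rewrite indicE memNset// mul0r; exact: cst_continuous.
Qed.

Lemma regularize X Om : continuous_local_martingale P F X ->
  F 0 Om -> (forall w, Om w -> continuous_path (X ^~ w)) ->
  (forall w, Om w -> X 0 w = 0) ->
  regular_local_martingale (regularized Om X).
Proof.
move=> [aX _ [tau ltau mtau]] FO cO O0.
have mO : measurable Om by apply: (filtration_measurable hF _ FO).
split.
- exact: regularized_adapted.
- by move=> w; apply: regularized_continuous => /cO.
- move=> w; rewrite /regularized maxxx indicE; have [Ow|Ow] := boolP (w \in Om).
    by rewrite O0 ?mulr0//; apply: set_mem.
  by rewrite mul0r.
exists tau => // n; have [aY iY _] := mtau n.
have tau0 w : (0 <= tau n w)%E by case: ltau => /(_ n) [].
have E t w : 0 <= t -> stopped (regularized Om X) (tau n) t w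
   = \1_Om w * (stopped X (tau n) t w - X 0 w).
  move=> t0; rewrite /stopped /regularized max_l; last first.
    by case/andP: (until_itv t0 (tau0 w)).
  rewrite indicE; have [Ow|Ow] := boolP (w \in Om); last by rewrite !mul0r.
  by rewrite (O0 _ (set_mem Ow)) subr0.
have EE t : 0 <= t -> stopped (regularized Om X) (tau n) t
   = (fun w => \1_Om w * (stopped X (tau n) t w - X 0 w)).
  by move=> t0; apply/funext => w; exact: E.
apply: (martingale_of_increments hF).
- move=> t t0; rewrite EE//.
  have := adaptedM hF (_ : adapted F (fun _ => \1_Om)) aY; apply => //.
  exact: adapted_indic.
- move=> t t0; rewrite EE//; apply: integrable_rv_indic => //; exact: iY.
- move=> s t B s0 st FB; have t0 := le_trans s0 st; rewrite !EE//.
  rewrite -[RHS](@martingale_increment _ _ _ _ _ hF _ s t (B `&` Om) (mtau n))//.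
    apply: eq_Rintegral => w _; rewrite -mulrBr mulrA.
    by rewrite !indicE in_setI -natrM mulnb.
  have sF := filtration_sigma hF s0; apply: (sub_setI sF) => //.
  exact: filtration_le FO.
Qed.

End local_martingales.

(** * Comparison of two exit times along one path *)

Section pathwise.
Context {R : realType}.
Implicit Types (x m a : R -> R).

Lemma le_hit_level x b c : b <= c -> (hit x b <= hit x c)%E.
Proof.
move=> bc; apply: ereal_inf_le_tmp => _ [t [t0 xt] <-].
by exists t => //; split=> //; apply: le_trans xt.
Qed.

Lemma running_max_nondecreasing x t : continuous x -> 0 <= t ->
  nondecreasing_path x -> running_max x t = x t.
Proof.
move=> cx t0 nx; apply/eqP; rewrite eq_le; apply/andP; split.
  by have [s /andP[s0 st] ->] := running_max_attained cx t0; apply: nx.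
by apply: le_running_max => //; rewrite t0 lexx.
Qed.

Lemma until_lt_hit x b r (S : \bar R) : continuous x -> 0 <= r -> running_max x r < b ->
  until r (Order.min (hit x b) S) = until r S.
Proof.
move=> cx r0 xb; have rh : (r%:E <= hit x b)%E.
  by rewrite leNgt; apply/negP => /ltW; rewrite hit_le// leNgt xb.
by rewrite untilA ?hit_ge0// (until_id rh).
Qed.

Lemma until_hit x b t : continuous x -> 0 <= t -> x 0 <= b -> b <= running_max x t ->
  [/\ 0 <= until t (hit x b) <= t, (until t (hit x b))%:E = hit x b &
    x (until t (hit x b)) = b].
Proof.
move=> cx t0 x0 xb; rewrite until_itv ?hit_ge0//.
have ht : (hit x b <= t%:E)%E by rewrite hit_le.
case E : (hit x b) ht (hit_ge0 x b) => [h| |]//.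
by rewrite lee_fin => ht h0; rewrite until_fin//; split=> //; apply: (hit_value cx x0).
Qed.

Lemma le_until r (S S' : \bar R) : (0 <= S)%E -> (S <= S')%E -> until r S <= until r S'.
Proof.
move=> S0 SS; have S'0 := le_trans S0 SS.
rewrite -(min_l SS); rewrite minC untilA//.
rewrite /until; case: S S0 {SS} => [s| |] // s0.
  by rewrite -EFin_min /= ge_min lexx.
by rewrite miney.
Qed.

(** The barrier c on |m| keeps m small while the bracket a grows from b to 4 b,
that is between the exits for k = 1 and k = 4. *)
Section bracket_side.
Variables (m a : R -> R) (r b c : R).
Hypotheses (cm : continuous m) (ca : continuous a) (m0 : m 0 = 0) (a0 : a 0 = 0).
Hypothesis na : nondecreasing_path a.
Hypotheses (r0 : 0 <= r) (b0 : 0 < b) (c0 : 0 < c).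

Let cnm : continuous (fun t => `|m t|).
Proof. by move=> t; apply: cvg_norm; exact: cm. Qed.

Definition bracket_exit k := Order.min (hit a (k * b)) (hit (fun t => `|m t|) c).

Let bracket_exit_ge0 k : (0 <= bracket_exit k)%E.
Proof. by rewrite le_min !hit_ge0. Qed.

Lemma bracket_exit_bound k t : 0 <= k -> 0 <= t ->
  [/\ `|m (until t (bracket_exit k))| <= c,
   0 <= a (until t (bracket_exit k)) & a (until t (bracket_exit k)) <= k * b].
Proof.
move=> k0 t0; have := until_le t0 (bracket_exit_ge0 k).
have /andP[v0 _] := until_itv t0 (bracket_exit_ge0 k).
rewrite {2}/bracket_exit le_min => /andP[va vm]; split.
- by apply: (le_hit cnm _ v0 vm); rewrite m0 normr0 ltW.
- by rewrite -a0; apply: na.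
- by apply: (le_hit ca _ v0 va); rewrite a0 mulr_ge0// ltW.
Qed.

Let exit_le : until r (bracket_exit 1) <= until r (bracket_exit 4).
Proof.
apply: le_until => //; rewrite /bracket_exit le_min !ge_min lexx orbT andbT.
by rewrite le_hit_level// ler_wpM2r ?ler1n// ltW.
Qed.

(** On the event on the left the exit is caused by a for both values of k, at
the levels b and 4 b. *)
Lemma bracket_growth :
  3 * b * ((4 * b <= a r) && (running_max (fun t => `|m t|) r < c))%:R
  <= a (until r (bracket_exit 4)) - a (until r (bracket_exit 1)).
Proof.
case: (boolP (_ && _)) => [/andP[ar mr]|_]; last first.
  rewrite mulr0 subr_ge0; apply: na => //.
  by case/andP: (until_itv r0 (bracket_exit_ge0 1)).
have aE k : 0 <= k <= 4 -> a (until r (bracket_exit k)) = k * b.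
  move=> /andP[k0 k4]; rewrite /bracket_exit minC until_lt_hit//.
  have [||_ _ ->//] := until_hit (b := k * b) ca r0.
    by rewrite a0 mulr_ge0// ltW.
  rewrite running_max_nondecreasing//; apply: le_trans ar.
  by rewrite ler_pM2r.
have -> : a (until r (bracket_exit 4)) = 4 * b by apply: aE; rewrite lexx andbT.
have -> : a (until r (bracket_exit 1)) = 1 * b by apply: aE; rewrite ler01 ler1n.
by rewrite mulr1; lra.
Qed.

(** If a r < b, the exit before r can only be caused by m, so that the two
times coincide. Otherwise m ^ 2 <= c ^ 2 at the exit. *)
Lemma martingale_growth :
  m (until r (bracket_exit 4)) ^+ 2 - m (until r (bracket_exit 1)) ^+ 2 <=
  c ^+ 2 * (b <= a r)%R%:R.
Proof.
have [ab|ab] := leP b (a r).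
  rewrite mulr1; have [mc _ _] := bracket_exit_bound (ler0n R 4) r0.
  rewrite lerBlDr (le_trans (y := c ^+ 2)) ?lerDl ?sqr_ge0//.
  by rewrite -real_normK ?num_real// lerXn2r ?nnegrE// ltW.
have aE k : 1 <= k -> until r (bracket_exit k) = until r (hit (fun t => `|m t|) c).
  move=> k1; rewrite /bracket_exit until_lt_hit// running_max_nondecreasing//.
  by apply: (lt_le_trans ab); rewrite ler_peMl// ltW.
by rewrite !aE// ?ler1n// subrr mulr0.
Qed.

End bracket_side.

(** The early exit adds to the late one the one-sided barrier e m >= b, with e = 1
or e = -1. If this barrier causes the exit, the value of m is known there, and
not just its absolute value. *)
Section martingale_side.
Variables (m a : R -> R) (r b c : R).
Hypotheses (cm : continuous m) (ca : continuous a) (m0 : m 0 = 0) (a0 : a 0 = 0).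
Hypothesis na : nondecreasing_path a.
Hypotheses (r0 : 0 <= r) (b0 : 0 < b) (c0 : 0 < c).

Let cnm : continuous (fun t => `|m t|).
Proof. by move=> t; apply: cvg_norm; exact: cm. Qed.

Let csm e : continuous (fun t => e * m t).
Proof. by move=> t; apply: cvgM; [exact: cvg_cst|exact: cm]. Qed.

Definition late_exit := Order.min (hit (fun t => `|m t|) (2 * b)) (hit a c).
Definition early_exit (e : R) := Order.min late_exit (hit (fun t => e * m t) b).

Let late_exit_ge0 : (0 <= late_exit)%E.
Proof. by rewrite le_min !hit_ge0. Qed.

Let early_exit_ge0 e : (0 <= early_exit e)%E.
Proof. by rewrite le_min late_exit_ge0 hit_ge0. Qed.

Lemma late_exit_bound v : 0 <= v -> (v%:E <= late_exit)%E ->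
  [/\ `|m v| <= 2 * b, 0 <= a v & a v <= c].
Proof.
move=> v0; rewrite le_min => /andP[vm va]; split.
- by apply: (le_hit cnm _ v0 vm); rewrite m0 normr0 mulr_ge0// ltW.
- by rewrite -a0; apply: na.
- by apply: (le_hit ca _ v0 va); rewrite a0 ltW.
Qed.

Let v2 := until r late_exit.
Let v1 e := until r (early_exit e).

Let v2_itv : 0 <= v2 <= r. Proof. exact: until_itv. Qed.
Let v2_ge0 : 0 <= v2. Proof. by case/andP: v2_itv. Qed.

Let v1E e : v1 e = until v2 (hit (fun t => e * m t) b).
Proof. by rewrite /v1 /early_exit untilA. Qed.

(** With e ^ 2 = 1 this is the increment of m ^ 2 - 2 b e m between the early and
the late exit: a combination of the two local martingales with constant
coefficients, up to the increment of a. The sign e is what avoids the product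
of the increment of m with the random value of m at the early exit. *)
Definition sq_growth e := (e * m v2 - b) ^+ 2 - (e * m (v1 e) - b) ^+ 2.

Let hit_case e : 
  (running_max (fun t => e * m t) v2 < b /\ v1 e = v2) \/
  (b <= running_max (fun t => e * m t) v2 /\ e * m (v1 e) = b).
Proof.
have [bm|mb] := leP b (running_max (fun t => e * m t) v2); last first.
  by left; split=> //; rewrite v1E -(minye (hit _ _)) minC until_lt_hit// /until miney.
right; split => //; rewrite v1E.
have [||_ _ ->//] := until_hit (b := b) (@csm e) v2_ge0 => //.
by rewrite m0 mulr0 ltW.
Qed.

(** The second square vanishes if the early exit is caused by e m, and
otherwise the two times coincide. *)
Lemma sq_growth_ge0 e : 0 <= sq_growth e.
Proof.
rewrite /sq_growth; have [[_ ->]|[_ ->]] := hit_case e; first by rewrite subrr.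
by rewrite subrr expr0n subr0 sqr_ge0.
Qed.

(** On the event on the left m reaches 2 b or -2 b at the late exit, hence b or
-b before it, and the square grows from 0 to b ^ 2 for the matching sign e. *)
Lemma sq_growth_event :
  b ^+ 2 * ((2 * b <= running_max (fun t => `|m t|) r) && (a r < c))%:R <=
  sq_growth 1 + sq_growth (-1).
Proof.
have g1 := sq_growth_ge0 1; have gN1 := sq_growth_ge0 (-1).
case: (boolP (_ && _)) => [/andP[mr ar]|_]; last by rewrite mulr0 addr_ge0.
have v2E : v2 = until r (hit (fun t => `|m t|) (2 * b)).
  by rewrite /v2 /late_exit minC until_lt_hit// running_max_nondecreasing.
have mv2 : `|m v2| = 2 * b.
  rewrite v2E; have [||_ _ ->//] := until_hit (b := 2 * b) cnm r0 => //.
  by rewrite m0 normr0 mulr_ge0// ltW.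
have main e : e * m v2 = 2 * b -> b ^+ 2 <= sq_growth e.
  move=> ev2; rewrite /sq_growth; have [[H _]|[_ ->]] := hit_case e.
    have := @le_running_max _ (fun t => e * m t) v2 v2 (@csm e).
    rewrite v2_ge0 lexx ev2 => /(_ isT) /le_lt_trans /(_ H).
    by rewrite ltNge ler_peMl ?ler1n// ltW.
  by rewrite ev2 subrr expr0n subr0; have -> : 2 * b - b = b by lra.
rewrite mulr1; have [mp|mn] := leP 0 (m v2).
  by have := main 1; rewrite mul1r -mv2 ger0_norm// => /(_ erefl) H;
    rewrite (le_trans H) ?lerDl.
by have := main (-1); rewrite mulN1r -mv2 ltr0_norm// => /(_ erefl) H;
  rewrite (le_trans H) ?lerDr.
Qed.

Lemma late_growth e : `|e| <= 1 ->
  a v2 - a (v1 e) <= c * (b <= running_max (fun t => `|m t|) r)%R%:R.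
Proof.
move=> e1; have [_ av0 avc] := late_exit_bound v2_ge0 (until_le r0 late_exit_ge0).
have [bm|mb] := leP b (running_max (fun t => `|m t|) r).
  rewrite mulr1; suff : 0 <= a (v1 e) by move: avc; rewrite -/v2; lra.
  rewrite -a0; apply: na => //.
  by case/andP: (until_itv r0 (early_exit_ge0 e)).
rewrite mulr0; have [[_ ->]|[bv _]] := hit_case e; first by rewrite subrr.
have [s /andP[s0 sv] E] := running_max_attained (@csm e) v2_ge0.
move: mb; rewrite ltNge => /negP; case; apply: (le_trans bv); rewrite E.
apply: (@le_trans _ _ `|m s|).
  apply: le_trans (ler_norm _) _; rewrite normrM ler_piMl//.
apply: (@le_running_max _ (fun t => `|m t|)) => //.
by rewrite s0 (le_trans sv)//; case/andP: v2_itv.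
Qed.

End martingale_side.
End pathwise.

(** * Good-lambda inequalities at a pseudo-stopping time *)

Section good_lambda.
Context d (T : measurableType d) (R : realType) (P : probability T R).
Context (F : R -> set (set T)) (M A : R -> T -> R) (rho : T -> \bar R).
Hypotheses (hF : filtration F) (cF : complete_filtration P F).
Hypothesis rM : regular_local_martingale P F M.
Hypothesis rL : regular_local_martingale P F (fun t w => M t w ^+ 2 - A t w).
Hypothesis aA : adapted F A.
Hypothesis cA : forall w, continuous (A ^~ w).
Hypothesis A0 : forall w, A 0 w = 0.
Hypothesis nA : forall w, nondecreasing_path (A ^~ w).
Hypothesis hrho : pseudo_stopping_time P F rho.
Hypothesis rhoy : P [set w | rho w = +oo%E] = 0%E.

Let r w := fine (rho w).

Let r0 w : 0 <= r w. Proof. by have [[_ r_ge0] _] := hrho; rewrite /r fine_ge0. Qed.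

Let mr : measurable_fun setT r.
Proof.
have [[mrho _] _] := hrho.
by apply: measurableT_comp => //; exact: fine_measurable.
Qed.

Let aM : adapted F M. Proof. by have [] := rM. Qed.
Let cM w : continuous (M ^~ w). Proof. by have [_ + _ _] := rM. Qed.
Let M0 w : M 0 w = 0. Proof. by have [_ _ + _] := rM. Qed.

Let anM : adapted F (fun t w => `|M t w|).
Proof. by apply: (adapted_comp _ aM); exact: normr_measurable. Qed.
Let cnM w : continuous (fun t => `|M t w|).
Proof. by move=> t; apply: cvg_norm; exact: cM. Qed.

Lemma measurable_running_sup :
  measurable_fun setT (fun w => running_max (fun t => `|M t w|) (r w)).
Proof.
apply: (@measurable_running_max _ _ _ (fun t w => `|M t w|)) => // s s0 _.
exact: (adapted_measurable hF anM).
Qed.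

Lemma measurable_at_random X : adapted F X -> (forall w, continuous (X ^~ w)) ->
  measurable_fun setT (fun w => X (r w) w).
Proof.
move=> aX cX; apply: measurable_eval => // s s0 _.
exact: (adapted_measurable hF aX).
Qed.

Local Notation eval X := (at_exit X rho).

Let eval_integrable X S K : adapted F X -> (forall w, continuous (X ^~ w)) ->
  stopping_time F S -> (forall t w, 0 <= t -> `|X (until t (S w)) w| <= K) ->
  integrable_rv P (eval X S).
Proof.
move=> aX cX hS XK; apply: (@bounded_integrable_rv _ _ _ _ _ K).
  have [S0 _] := hS; have aXS := stopped_adapted hF aX cX hS.
  apply: (@measurable_eval _ _ _ (stopped X S)) => // [w|s s0 _].
    move=> u; apply: (@cvg_comp _ _ _ (fun u => until u (S w)) (X ^~ w) _
    (nbhs (until u (S w)))); [exact: continuous_until|exact: cX].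
  exact: (adapted_measurable hF aXS).
by move=> w; rewrite /at_exit; exact: (XK _ _ (r0 w)).
Qed.

Let aM2 : adapted F (fun t w => M t w ^+ 2).
Proof. exact: (@adapted_comp _ _ _ _ M (fun x => x ^+ 2) (exprn_measurable 2) aM). Qed.
Let cM2 w : continuous (fun t => M t w ^+ 2).
Proof. by move=> t; apply: cvgM; exact: cM. Qed.

Section exit.
Variables (S : T -> \bar R) (K1 K2 : R).
Hypothesis hS : stopping_time F S.
Hypothesis MK : forall t w, 0 <= t -> `|M (until t (S w)) w| <= K1.
Hypothesis AK : forall t w, 0 <= t -> 0 <= A (until t (S w)) w <= K2.

Lemma exit_integrable : integrable_rv P (eval M S).
Proof. exact: eval_integrable MK. Qed.

Lemma exit_mean : \int[P]_w eval M S w = 0.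
Proof. exact: (pseudo_stopped_mean hF cF rM hS MK hrho rhoy). Qed.

Let M2K t w : 0 <= t -> `|M (until t (S w)) w ^+ 2| <= K1 ^+ 2.
Proof.
move=> t0; rewrite normrX lerXn2r ?nnegrE ?MK//.
by apply: le_trans (MK w t0).
Qed.

Let AK' t w : 0 <= t -> `|A (until t (S w)) w| <= K2.
Proof. by move=> /(AK w)/andP[? ?]; rewrite ger0_norm. Qed.

Lemma exit_sq_integrable : integrable_rv P (fun w => eval M S w ^+ 2).
Proof. exact: (@eval_integrable (fun t w => M t w ^+ 2) _ (K1 ^+ 2)). Qed.

Lemma exit_bracket_integrable : integrable_rv P (eval A S).
Proof. exact: eval_integrable AK'. Qed.

(** The stopped local martingale M ^ 2 - A is bounded, so that its mean at rho
is 0. *)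
Lemma exit_sq_mean : \int[P]_w eval M S w ^+ 2 = \int[P]_w eval A S w.
Proof.
apply/eqP; rewrite -subr_eq0 -RintegralB//.
- have := @pseudo_stopped_mean _ _ _ P F hF cF _ S (K1 ^+ 2 + K2) rho rL hS.
  rewrite /at_exit => -> // t w t0; rewrite /stopped.
  by apply: (le_trans (ler_normB _ _)); apply: lerD; [exact: M2K|exact: AK'].
- exact: exit_sq_integrable.
- exact: exit_bracket_integrable.
Qed.

End exit.

Let mAr : measurable_fun setT (fun w => A (r w) w).
Proof. exact: measurable_at_random. Qed.

Let Msup w := running_max (fun t => `|M t w|) (r w).

(** Between the exits for k = 1 and k = 4 the increments of A and of M ^ 2 have
the same mean; the former is bounded below by [bracket_growth] and the latter
above by [martingale_growth]. *)
Lemma good_lambda_bracket b c : 0 < b -> 0 < c ->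
  3 * b * \int[P]_w ((4 * b <= A (r w) w) && (Msup w < c))%:R <=
  c ^+ 2 * \int[P]_w (b <= A (r w) w)%R%:R.
Proof.
move=> b0 c0.
pose S k w := bracket_exit (M ^~ w) (A ^~ w) b c k.
have hS k : stopping_time F (S k).
  by apply: min_stopping_time; [exact: hF|exact: hit_stopping_time|
    exact: (hit_stopping_time (X := fun t w => `|M t w|) hF)].
have bd k t w : 0 <= k -> 0 <= t -> [/\ `|M (until t (S k w)) w| <= c,
    0 <= A (until t (S k w)) w & A (until t (S k w)) w <= k * b].
  by move=> k0 t0; apply: (@bracket_exit_bound _ (M ^~ w) (A ^~ w) b c).
have MS k t w : 0 <= k -> 0 <= t -> `|M (until t (S k w)) w| <= c.
  by move=> k0 t0; case: (bd k t w k0 t0).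
have AS k t w : 0 <= k -> 0 <= t -> 0 <= A (until t (S k w)) w <= k * b.
  by move=> k0 t0; case: (bd k t w k0 t0) => _ -> ->.
have iA k : 0 <= k -> integrable_rv P (eval A (S k)).
  by move=> k0; apply: (exit_bracket_integrable (K2 := k * b)) => // t w; exact: AS.
have iM2 k : 0 <= k -> integrable_rv P (fun w => eval M (S k) w ^+ 2).
  by move=> k0; apply: (exit_sq_integrable (K1 := c)) => // t w; exact: MS.
have mean k : 0 <= k -> \int[P]_w eval M (S k) w ^+ 2 = \int[P]_w eval A (S k) w.
  move=> k0; apply: (@exit_sq_mean (S k) c (k * b)) => // t w; [exact: MS|exact: AS].
have iE : integrable_rv P (fun w => ((4 * b <= A (r w) w) && (Msup w < c))%:R).
  apply: integrable_bool; apply: measurable_and; first exact: measurable_fun_ler.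
  by apply: measurable_fun_ltr => //; exact: measurable_running_sup.
have iE' : integrable_rv P (fun w => (b <= A (r w) w)%R%:R).
  by apply: integrable_bool; exact: measurable_fun_ler.
rewrite -!RintegralZl//.
apply: (@le_trans _ _ (\int[P]_w (eval A (S 4) w - eval A (S 1) w))).
  apply: le_Rintegral => //; first exact: integrable_rvZ.
    by apply: integrable_rvB; exact: iA.
  by move=> w _; apply: (@bracket_growth _ (M ^~ w) (A ^~ w)).
have -> : \int[P]_w (eval A (S 4) w - eval A (S 1) w) =
    \int[P]_w (eval M (S 4) w ^+ 2 - eval M (S 1) w ^+ 2).
  have [iA4 iA1] := (iA 4 (ler0n _ _), iA 1 ler01).
  have [iM4 iM1] := (iM2 4 (ler0n _ _), iM2 1 ler01).
  by rewrite !RintegralB// !mean.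
apply: le_Rintegral => //.
- by apply: integrable_rvB; exact: iM2.
- exact: integrable_rvZ.
- by move=> w _; apply: (@martingale_growth _ (M ^~ w) (A ^~ w)) => //; exact: r0.
Qed.

(** The means of the square growth and of the increment of A between the early
and the late exit agree for both signs. The factor 2 comes from adding the two
signs. *)
Lemma good_lambda_martingale b c : 0 < b -> 0 < c ->
  b ^+ 2 * \int[P]_w ((2 * b <= Msup w) && (A (r w) w < c))%:R <=
  2 * c * \int[P]_w (b <= Msup w)%R%:R.
Proof.
move=> b0 c0.
pose S2 w := late_exit (M ^~ w) (A ^~ w) b c.
pose S1 e w := early_exit (M ^~ w) (A ^~ w) b c e.
have hS2 : stopping_time F S2.
  by apply: min_stopping_time; [exact: hF|
    exact: (hit_stopping_time (X := fun t w => `|M t w|) hF)|exact: hit_stopping_time].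
have hS1 e : stopping_time F (S1 e).
  apply: min_stopping_time; [exact: hF|exact: hS2|].
  apply: (hit_stopping_time (X := fun t w => e * M t w) hF).
    by apply: (adapted_comp _ aM); exact: measurable_funM.
  by move=> w t; apply: cvgM; [exact: cvg_cst|exact: cM].
have S2_ge0 w : (0 <= S2 w)%E by case: hS2.
have bd S t w : (0 <= S)%E -> (S <= S2 w)%E -> 0 <= t -> [/\ `|M (until t S) w| <= 2 * b,
    0 <= A (until t S) w & A (until t S) w <= c].
  move=> S0 SS t0; apply: (@late_exit_bound _ (M ^~ w) (A ^~ w) b c) => //.
    by case/andP: (until_itv t0 S0).
  exact: le_trans (until_le t0 S0) SS.
have mean S : stopping_time F S -> (forall w, S w <= S2 w)%E ->
  [/\ integrable_rv P (eval A S), integrable_rv P (eval M S),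
      integrable_rv P (fun w => eval M S w ^+ 2), \int[P]_w eval M S w = 0 &
   \int[P]_w eval M S w ^+ 2 = \int[P]_w eval A S w].
  move=> hS SS; have [S0 _] := hS.
  have MS t w : 0 <= t -> `|M (until t (S w)) w| <= 2 * b.
    by move=> t0; case: (bd (S w) t w).
  have AS t w : 0 <= t -> 0 <= A (until t (S w)) w <= c.
    by move=> t0; case: (bd (S w) t w) => // _ -> ->.
  split.
  - exact: exit_bracket_integrable AS.
  - exact: (@exit_integrable S _ hS MS).
  - exact: (@exit_sq_integrable S _ hS MS).
  - exact: (@exit_mean S _ hS MS).
  - exact: (@exit_sq_mean S _ _ hS MS AS).
have [iA2 iM2 iMM2 m2 mm2] := mean S2 hS2 (fun w => lexx _).
have SS e w : (S1 e w <= S2 w)%E by rewrite /S1 /early_exit ge_min lexx.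
have iE : integrable_rv P (fun w => ((2 * b <= Msup w) && (A (r w) w < c))%:R).
  apply: integrable_bool; apply: measurable_and; last exact: measurable_fun_ltr.
  by apply: measurable_fun_ler => //; exact: measurable_running_sup.
have iE' : integrable_rv P (fun w => (b <= Msup w)%R%:R).
  by apply: integrable_bool; apply: measurable_fun_ler => //;
    exact: measurable_running_sup.
pose g e w := sq_growth (M ^~ w) (A ^~ w) (r w) b c e.
have gE e w : e ^+ 2 = 1 -> g e w = (eval M S2 w ^+ 2 - eval M (S1 e) w ^+ 2) -
    2 * b * e * (eval M S2 w - eval M (S1 e) w).
  move=> e1; rewrite /g /sq_growth !sqrrB !exprMn e1 -/(S2 w) -/(S1 e w).
  by rewrite /at_exit; ring.
have ig e : e ^+ 2 = 1 -> integrable_rv P (g e).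
  move=> e1; have -> : g e = (fun w => (eval M S2 w ^+ 2 - eval M (S1 e) w ^+ 2) -
      2 * b * e * (eval M S2 w - eval M (S1 e) w)).
    by apply/funext => w; exact: gE.
  have [iA1 iM1 iMM1 m1 mm1] := mean (S1 e) (hS1 e) (SS e).
  apply: integrable_rvB; first exact: integrable_rvB.
  by apply: integrable_rvZ; exact: integrable_rvB.
have main e : `|e| <= 1 -> e ^+ 2 = 1 ->
    \int[P]_w g e w <= c * \int[P]_w (b <= Msup w)%R%:R.
  move=> e1 ee; have [iA1 iM1 iMM1 m1 mm1] := mean (S1 e) (hS1 e) (SS e).
  under eq_Rintegral do rewrite gE//.
  rewrite RintegralB//; last 2 first.
  - exact: integrable_rvB.
  - by apply: integrable_rvZ; exact: integrable_rvB.
  (* M has mean 0 at both exits, M ^ 2 has there the same mean as A. *)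
  rewrite RintegralZl//; last exact: integrable_rvB.
  rewrite !RintegralB// m1 m2 subrr mulr0 subr0 mm1 mm2 -RintegralB// -RintegralZl//.
  apply: le_Rintegral => //; [exact: integrable_rvB|exact: integrable_rvZ|].
  by move=> w _; apply: (@late_growth _ (M ^~ w) (A ^~ w)) => //; exact: r0.
rewrite -RintegralZl//.
apply: (@le_trans _ _ (\int[P]_w (g 1 w + g (-1) w))).
  apply: le_Rintegral => //; first exact: integrable_rvZ.
    by apply: integrable_rvD; apply: ig; rewrite ?expr1n ?sqrrN ?expr1n.
  by move=> w _; apply: (@sq_growth_event _ (M ^~ w) (A ^~ w)) => //; exact: r0.
rewrite RintegralD//; last 2 first.
- by apply: ig; rewrite expr1n.
- by apply: ig; rewrite sqrrN expr1n.
have H1 := main 1; have H2 := main (-1).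
rewrite mulr_natl mulr2n mulrDl; apply: lerD; [apply: H1|apply: H2];
  by rewrite ?normrN ?normr1 ?sqrrN ?expr1n.
Qed.

End good_lambda.

(** * From good-lambda inequalities to moments *)

Section dyadic.
Context {R : realType} (p u : R).
Hypotheses (p0 : 0 < p) (u0 : 0 < u).

Let q : R := 2 `^ p.
Let a k := (u * 2 ^+ k) `^ p.

(** Comparable to x ^ p for x between u and 2 ^ n u, see [powR_le_dyadic] and
[dyadic_le_powR]: the tails of a random variable at finitely many levels
determine its p-th moment up to a constant and two truncations. *)
Definition dyadic n x : R := \sum_(k < n) (u * 2 ^+ k) `^ p * (u * 2 ^+ k <= x)%R%:R.

Let lev0 k : 0 <= u * 2 ^+ k. Proof. by rewrite mulr_ge0 ?exprn_ge0// ltW. Qed.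

Let aS k : a k.+1 = q * a k.
Proof. by rewrite /a exprSr mulrA [LHS]powRM// mulrC. Qed.

Lemma powR2_gt1 : 1 < q.
Proof.
have := @gt0_ltr_powR R p p0 1 2; rewrite !nnegrE ler01 powR1 ltr1n => H.
exact: H.
Qed.

Let mono x y : 0 <= x -> x <= y -> x `^ p <= y `^ p.
Proof.
move=> x0 xy; apply: ge0_ler_powR => //; rewrite ?nnegrE//; first exact: ltW.
exact: le_trans xy.
Qed.

Lemma dyadic_ge0 n x : 0 <= dyadic n x.
Proof. by apply: sumr_ge0 => k _; rewrite mulr_ge0 ?powR_ge0. Qed.

(** If x lies between u 2 ^ k and u 2 ^ (k + 1), the term of index k alone is at
least 2 ^ - p times x ^ p. *)
Lemma powR_le_dyadic n x : 0 <= x -> x < u * 2 ^+ n ->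
  x `^ p <= u `^ p + q * dyadic n x.
Proof.
move=> x0; have r1 := powR2_gt1.
elim: n => [|n IH].
  rewrite expr0 mulr1 => xu; rewrite /dyadic big_ord0 mulr0 addr0.
  by apply: mono => //; exact: ltW.
move=> xn; rewrite /dyadic big_ord_recr/= -/(dyadic n x).
have [nx|/IH {}IH] := leP (u * 2 ^+ n) x.
  rewrite mulr1 mulrDr addrA -aS; apply: (@le_trans _ _ (a n.+1)).
    by apply: mono => //; exact: ltW.
  rewrite lerDr addr_ge0 ?powR_ge0// mulr_ge0 ?dyadic_ge0//.
  by rewrite (le_trans ler01)// ltW.
by rewrite mulr0 addr0.
Qed.

(** The nonzero terms form a geometric progression of ratio q = 2 ^ p, whose
last term is at most x ^ p. *)
Lemma dyadic_le_powR n x : 0 <= x -> (q - 1) * dyadic n x <= q * x `^ p.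
Proof.
move=> x0; have r1 := powR2_gt1; have r0 : 0 <= q by rewrite (le_trans ler01)// ltW.
elim: n => [|n IH]; first by rewrite /dyadic big_ord0 mulr0 mulr_ge0// powR_ge0.
have [nx|nx] := leP (u * 2 ^+ n) x; last first.
  by rewrite /dyadic big_ord_recr/= (lt_geF nx) mulr0 addr0.
apply: (@le_trans _ _ (q * a n)); last by rewrite ler_wpM2l// mono.
apply: (@le_trans _ _ ((q - 1) * \sum_(k < n.+1) a k)).
  rewrite ler_wpM2l ?subr_ge0 ?(ltW r1)//; apply: ler_sum => k _.
  by rewrite ler_piMr ?powR_ge0// lern1 leq_b1.
have -> : (q - 1) * \sum_(k < n.+1) a k = q * a n - a 0%N.
  elim: (n) => [|m IHm]; first by rewrite big_ord1; ring.
  by rewrite big_ord_recr/= mulrDr IHm aS; ring.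
by rewrite lerBlDr lerDl powR_ge0.
Qed.

End dyadic.

Section moments.
Context d (T : measurableType d) (R : realType) (P : probability T R).

Definition moment_constant (p delta : R) : R :=
  2 * (2 `^ p) ^+ 3 / (2 `^ p - 1) * delta^-1 `^ p.

Lemma moment_constant_gt0 p delta : 0 < p -> 0 < delta -> 0 < moment_constant p delta.
Proof.
move=> p0 d0; have r1 := powR2_gt1 p0.
by rewrite /moment_constant mulr_gt0 ?powR_gt0 ?invr_gt0// divr_gt0 ?subr_gt0//
  mulr_gt0// exprn_gt0// powR_gt0.
Qed.

Variables (X Y : T -> R) (p delta eps : R).
Hypotheses (mX : measurable_fun setT X) (mY : measurable_fun setT Y).
Hypotheses (X0 : forall w, 0 <= X w) (Y0 : forall w, 0 <= Y w).
Hypotheses (p0 : 0 < p) (d0 : 0 < delta) (epsp : eps * 2 `^ p <= 2^-1).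
Hypothesis XY : forall l, 0 < l ->
  \int[P]_w ((2 * l <= X w) && (Y w < delta * l))%:R <= eps * \int[P]_w (l <= X w)%R%:R.

Let q : R := 2 `^ p.

Let q1 : 1 < q. Proof. exact: powR2_gt1. Qed.
Let q_gt0 : 0 < q. Proof. exact: lt_trans q1. Qed.

Let iX l : integrable_rv P (fun w => (l <= X w)%R%:R).
Proof. by apply: integrable_bool; apply: measurable_fun_ler. Qed.

Let Yd w := delta^-1 * Y w.

Let iY l : integrable_rv P (fun w => (l <= Yd w)%R%:R).
Proof.
by apply: integrable_bool; apply: measurable_fun_ler => //; exact: measurable_funM.
Qed.

Let Yd0 w : 0 <= Yd w. Proof. by rewrite mulr_ge0 ?invr_ge0// ltW. Qed.

Let doubling l : 0 < l -> \int[P]_w (2 * l <= X w)%R%:R <=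
  eps * \int[P]_w (l <= X w)%R%:R + \int[P]_w (l <= Yd w)%R%:R.
Proof.
move=> l0; have iXY : integrable_rv P (fun w => ((2 * l <= X w) && (Y w < delta * l))%:R).
  apply: integrable_bool; apply: measurable_and; first exact: measurable_fun_ler.
  exact: measurable_fun_ltr.
apply: le_trans (lerD (XY l0) (lexx _)); rewrite -RintegralD//; last exact: iY.
apply: le_Rintegral => //; first exact: iX.
  exact: integrable_rvD.
move=> w _.
rewrite /Yd ler_pdivlMl//; case: (2 * l <= X w) => /=; last by rewrite addr_ge0.
by case: ltP => _; rewrite ?lerDl ?add0r.
Qed.

Section level.
Variable u : R.
Hypothesis u0 : 0 < u.
Hypothesis iYp : integrable_rv P (fun w => Y w `^ p).

Let a k := (u * 2 ^+ k) `^ p.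
Let I k := \int[P]_w (u * 2 ^+ k <= X w)%R%:R.

Let lev0 k : 0 < u * 2 ^+ k. Proof. by rewrite mulr_gt0 ?exprn_gt0. Qed.

Let int_dyadic n : \int[P]_w dyadic p u n (X w) = \sum_(k < n) a k * I k.
Proof.
rewrite /dyadic Rintegral_sum; last by move=> k; exact: integrable_rvZ.
by apply: eq_bigr => k _; rewrite RintegralZl//; exact: iX.
Qed.

Let int_dyadicY n : \sum_(k < n) a k * \int[P]_w (u * 2 ^+ k <= Yd w)%R%:R <=
  q / (q - 1) * delta^-1 `^ p * \int[P]_w Y w `^ p.
Proof.
under eq_bigr do rewrite -(RintegralZl _ measurableT (iY _)).
rewrite -Rintegral_sum; last by move=> k; exact: integrable_rvZ.
rewrite -RintegralZl//; apply: le_Rintegral => //.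
- by apply: integrable_rv_sum => k; apply: integrable_rvZ; exact: iY.
- exact: integrable_rvZ.
move=> w _; rewrite -/(dyadic p u n (Yd w)).
have := @dyadic_le_powR _ p u p0 u0 n _ (Yd0 w).
rewrite -ler_pdivlMl ?subr_gt0// => /le_trans; apply.
by rewrite /Yd powRM// ?invr_ge0 ?(ltW d0)// !mulrA [_^-1 * _]mulrC.
Qed.

(** The good-lambda inequality bounds the level k + 1 of X by eps times its
level k plus the level k of Y / delta. Since q eps <= 1 / 2, at most half of
the sum comes back on the right, and it can be absorbed because it is
finite. *)
Let int_dyadicX n : \sum_(k < n) a k * I k <= 2 * u `^ p +
  2 * q * (q / (q - 1) * delta^-1 `^ p * \int[P]_w Y w `^ p).
Proof.
set J := (X in 2 * q * X).
have I0 k : 0 <= I k by apply: Rintegral_ge0.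
have a0 k : 0 <= a k by exact: powR_ge0.
have I1 : I 0%N <= 1.
  rewrite /I (le_trans (y := \int[P]_w 1))//; last first.
    by rewrite Rintegral_cst//= probability_setT mul1r.
  apply: le_Rintegral => //; [exact: iX|exact: finite_measure_integrable_cst|].
  by move=> w _; rewrite lern1 leq_b1.
have main : \sum_(k < n) a k * I k <=
    u `^ p + q * (eps * (\sum_(k < n) a k * I k) + J).
  apply: (@le_trans _ _ (\sum_(k < n.+1) a k * I k)).
    by rewrite big_ord_recr/= lerDl mulr_ge0.
  rewrite big_ord_recl/=; apply: lerD.
    by rewrite /a expr0 mulr1 ler_piMr// powR_ge0.
  apply: (@le_trans _ _ (\sum_(k < n) q * (a k *
    (eps * I k + \int[P]_w (u * 2 ^+ k <= Yd w)%R%:R)))).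
    apply: ler_sum => k _.
    have -> : a (lift ord0 k) = q * a k.
      by rewrite /a/= exprS mulrCA [LHS]powRM// ltW// lev0.
    rewrite -mulrA ler_wpM2l ?(ltW q_gt0)// ler_wpM2l//.
    have -> : I (lift ord0 k) = \int[P]_w (2 * (u * 2 ^+ k) <= X w)%R%:R.
      by rewrite /I /= exprS mulrCA.
    exact: doubling.
  rewrite -mulr_sumr ler_wpM2l ?(ltW q_gt0)//.
  apply: (@le_trans _ _ (\sum_(k < n) (eps * (a k * I k) +
    a k * \int[P]_w (u * 2 ^+ k <= Yd w)%R%:R))).
    by apply: ler_sum => k _; rewrite mulrDr mulrCA.
  by rewrite big_split/= -mulr_sumr lerD2l; exact: int_dyadicY.
have S0 : 0 <= \sum_(k < n) a k * I k by apply: sumr_ge0 => k _; rewrite mulr_ge0.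
set S := \sum_(k < n) a k * I k in main S0 *.
have : q * (eps * S) <= 2^-1 * S by rewrite mulrA [q * _]mulrC ler_wpM2r.
move: main; rewrite mulrDr; set x := u `^ p; set y := q * J.
rewrite -[2 * q * J]mulrA -/y; lra.
Qed.

Lemma truncated_integrable n :
  integrable_rv P (fun w => X w `^ p * (X w < u * 2 ^+ n)%R%:R).
Proof.
apply: (@bounded_integrable_rv _ _ _ _ _ ((u * 2 ^+ n) `^ p)).
  apply: measurable_funM; first exact: (measurableT_comp (measurable_powR p) mX).
  apply: (@integrable_rv_measurable _ _ _ P); apply: integrable_bool.
  exact: measurable_fun_ltr.
move=> w; case: ltP => Xu; last by rewrite mulr0 normr0 powR_ge0.
rewrite mulr1 ger0_norm ?powR_ge0//; apply: ge0_ler_powR => //;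
  rewrite ?nnegrE ?X0 ?(ltW p0) ?(ltW (lev0 _)) ?(ltW Xu)//.
Qed.

Lemma truncated_moment n :
  \int[P]_w (X w `^ p * (X w < u * 2 ^+ n)%R%:R) <=
  (1 + 2 * q) * u `^ p + moment_constant p delta * \int[P]_w Y w `^ p.
Proof.
have iD : integrable_rv P (fun w => dyadic p u n (X w)).
  by apply: integrable_rv_sum => k; apply: integrable_rvZ; exact: iX.
have iXt := truncated_integrable n.
apply: (@le_trans _ _ (\int[P]_w (u `^ p + q * dyadic p u n (X w)))).
  apply: le_Rintegral => //.
    apply: integrable_rvD; first exact: finite_measure_integrable_cst.
    exact: integrable_rvZ.
  move=> w _; case: ltP => Xu; first by rewrite mulr1; exact: powR_le_dyadic.
  by rewrite mulr0 addr_ge0 ?powR_ge0// mulr_ge0 ?dyadic_ge0// ltW.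
rewrite RintegralD//; last 2 first.
- exact: finite_measure_integrable_cst.
- exact: integrable_rvZ.
rewrite RintegralZl// int_dyadic Rintegral_cst//= probability_setT mulr1.
have := int_dyadicX n; rewrite -(ler_pM2l q_gt0).
rewrite /moment_constant -/q; set x := u `^ p; set S := q * \sum_(_ < _) _.
move=> H; apply: le_trans (lerD (lexx _) H) _.
rewrite le_eqVlt; apply/orP; left; apply/eqP; ring.
Qed.

End level.

(** In [truncated_moment] the upper truncation is removed by monotone
convergence, and the lower one by letting u tend to 0. *)
Lemma good_lambda_moment :
  (\int[P]_w (X w `^ p)%:E <= (moment_constant p delta)%:E * \int[P]_w (Y w `^ p)%:E)%E.
Proof.
have C0 := moment_constant_gt0 p0 d0.
have mYp : measurable_fun setT (fun w => Y w `^ p).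
  exact: (measurableT_comp (measurable_powR p) mY).
have mXp : measurable_fun setT (fun w => X w `^ p).
  exact: (measurableT_comp (measurable_powR p) mX).
have [Yoo|Yfin] := eqVneq (\int[P]_w (Y w `^ p)%:E)%E +oo%E.
  by rewrite Yoo gt0_muley ?lte_fin// leey.
have iYp : integrable_rv P (fun w => Y w `^ p).
  apply/integrableP; split; first exact/measurable_EFinP.
  under eq_integral do rewrite /= ger0_norm ?powR_ge0//.
  by rewrite ltey.
have YE : (\int[P]_w (Y w `^ p)%:E)%E = (\int[P]_w Y w `^ p)%:E.
  by rewrite fineK//; apply: (integrable_fin_num measurableT iYp).
rewrite YE -EFinM; apply/lee_addgt0Pr => e e0; rewrite -EFinD.
have k0 : 0 < 1 + 2 * q by rewrite addr_gt0// mulr_gt0.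
(* The level u for which the error term in the truncated bound is e. *)
pose u := (e / (1 + 2 * q)) `^ p^-1.
have u0 : 0 < u by rewrite powR_gt0// divr_gt0.
have uE : (1 + 2 * q) * u `^ p = e.
  by rewrite -powRrM mulVf ?gt_eqF// powRr1 ?divr_ge0 ?(ltW e0) ?(ltW k0)//
    mulrC divfK ?gt_eqF.
pose g n w := (X w `^ p * (X w < u * 2 ^+ n)%R%:R)%:E.
have mg n : measurable_fun setT (g n).
  apply/measurable_EFinP; apply: measurable_funM => //.
  apply: (@integrable_rv_measurable _ _ _ P); apply: integrable_bool.
  exact: measurable_fun_ltr.
have g0 n w : setT w -> (0 <= g n w)%E by rewrite lee_fin mulr_ge0 ?powR_ge0.
have gnd w : setT w -> {homo g ^~ w : n m / (n <= m)%N >-> (n <= m)%E}.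
  move=> _ n m nm; rewrite lee_fin ler_wpM2l ?powR_ge0// ler_nat.
  case: (ltP (X w)) => // Xn; rewrite (lt_le_trans Xn)//.
  by rewrite ler_pM2l// ler_weXn2l// ler1n.
have glim w : g n w @[n --> \oo] --> (X w `^ p)%:E.
  apply: cvg_near_cst.
  have [N XN] : exists N, X w < u * 2 ^+ N.
    exists (Num.truncn (X w / u)).+1; rewrite -ltr_pdivrMl// mulrC.
    apply: (lt_trans (truncnS_gt _)); rewrite -natrX ltr_nat; exact: ltn_expl.
  exists N => // n Nn /=; rewrite /g; have -> : X w < u * 2 ^+ n.
    by rewrite (lt_le_trans XN)// ler_pM2l// ler_weXn2l// ler1n.
  by rewrite mulr1.
have := @cvg_monotone_convergence _ _ _ P setT measurableT g mg g0 gnd.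
under eq_integral do rewrite (cvg_lim _ (glim _))//.
move=> /cvg_lim <-//; apply: lime_le.
  apply: ereal_nondecreasing_is_cvgn => n m nm.
  by apply: ge0_le_integral => // w _; [exact: g0|exact: gnd].
apply: nearW => n; have := truncated_moment u0 iYp n.
rewrite uE -lee_fin addrC; apply: le_trans.
rewrite /Rintegral fineK//.
exact: (integrable_fin_num measurableT (truncated_integrable u0 n)).
Qed.

End moments.

(** * The Burkholder-Davis-Gundy inequalities *)

Section regularized_data.
Context d (T : measurableType d) (R : realType) (P : probability T R).
Context (F : R -> set (set T)).
Hypotheses (hF : filtration F) (cF : complete_filtration P F).
Implicit Types (X M A : R -> T -> R).

Lemma F0_conull Om : {ae P, forall w, Om w} -> F 0 Om.
Proof.
move=> /cF; have [_ sD _] := filtration_sigma hF (lexx 0).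
move=> /sD; rewrite setTD.
by have -> : ~` (~` [set w | Om w]) = Om by rewrite setCK.
Qed.

Lemma running_sup_regularized Om M rho w : Om w -> continuous_path (M ^~ w) ->
  (0 <= rho w)%E -> rho w != +oo%E ->
  running_sup M rho w =
  (running_max (fun t => `|regularized Om M t w|) (fine (rho w)))%:E.
Proof.
move=> Ow cM; case rE : (rho w) => [r| |]//; rewrite lee_fin => r0 _ /=.
have cn : continuous (fun t => `|regularized Om M t w|).
  by move=> t; apply: cvg_norm; exact: (regularized_continuous (fun _ => cM)).
have E t : 0 <= t -> regularized Om M t w = M t w.
  by move=> t0; rewrite /regularized indicE mem_set// mul1r max_l.
apply/eqP; rewrite eq_le; apply/andP; split.
  apply: ge_ereal_sup => _ [t [t0 tr] <-]; rewrite lee_fin -E//.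
  apply: (le_running_max cn); rewrite t0 -lee_fin.
  by rewrite rE in tr.
have [s /andP[s0 sr] ->] := running_max_attained cn r0.
apply: ereal_sup_ubound; exists s; last by rewrite E.
by split => //; rewrite rE lee_fin.
Qed.

Lemma at_time_regularized Om A rho w : Om w -> (0 <= rho w)%E -> rho w != +oo%E ->
  at_time A rho w = (regularized Om A (fine (rho w)) w)%:E.
Proof.
move=> Ow; rewrite /at_time; case: (rho w) => [r| |]//; rewrite lee_fin => r0 _ /=.
by rewrite /regularized indicE mem_set// mul1r max_l.
Qed.

End regularized_data.

Theorem theorem2 (R : realType) (p : R) (p_gt0 : 0 < p) :
  exists c C : R, [/\ 0 < c, 0 < C &
    forall (d : measure_display) (T : measurableType d) (P : probability T R)
      (F : R -> set (set T)) (M A : R -> T -> R) (rho : T -> \bar R),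
      usual_hypotheses P F ->
      continuous_local_martingale P F M ->
      (\forall w \ae P, M 0 w = 0) ->
      is_bracket P F M A ->
      pseudo_stopping_time P F rho ->
      P [set w | rho w = +oo%E] = 0%E ->
      (c%:E * \int[P]_w (at_time A rho w `^ (p / 2))
         <= \int[P]_w (running_sup M rho w `^ p))%E /\
      (\int[P]_w (running_sup M rho w `^ p)
         <= C%:E * \int[P]_w (at_time A rho w `^ (p / 2)))%E].
Proof.
have q1 : 1 < 2 `^ p := powR2_gt1 p_gt0.
(* eps is the factor in the second good-lambda inequality; delta is chosen so
   that eps * 2 `^ p <= 1 / 2, which also suits the first one, whose factor
   delta ^+ 2 / 3 is smaller. *)
pose delta : R := (2 * 2 `^ p)^-1; pose eps : R := 2 * delta ^+ 2.
have d0 : 0 < delta by rewrite invr_gt0 mulr_gt0// powR_gt0.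
have epsp : eps * 2 `^ p <= 2^-1.
  rewrite /eps /delta; move: q1; set q := 2 `^ p => q1.
  have q0 : q != 0 by rewrite gt_eqF// (lt_trans _ q1).
  have -> : 2 * (2 * q)^-1 ^+ 2 * q = 2^-1 * q^-1 by field.
  by rewrite ler_piMr// invf_le1 ?(ltW q1)// (lt_trans _ q1).
have C0 := moment_constant_gt0 p_gt0 d0; set C := moment_constant p delta in C0.
exists C^-1, C; split => //; first by rewrite invr_gt0.
move=> d T P F M A rho [hF _ cF] lM M0 [aA A0 cA nA lL] hrho rhoy.
have [aM cM _] := lM.
pose Om := [set w | [/\ continuous_path (M ^~ w), M 0 w = 0,
  continuous_path (A ^~ w), A 0 w = 0 & nondecreasing_path (A ^~ w)]].
have aeOm : {ae P, forall w, Om w}.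
  by near do split.
have FOm := F0_conull hF cF aeOm.
pose M' := regularized Om M; pose A' := regularized Om A.
have rM : regular_local_martingale P F M'.
  by apply: regularize => // w [].
have rL : regular_local_martingale P F (fun t w => M' t w ^+ 2 - A' t w).
  rewrite (_ : (fun t w => _) = regularized Om (fun t w => M t w ^+ 2 - A t w)).
    apply: regularize => //; last by move=> w [_ -> _ -> _]; rewrite expr0n subr0.
    move=> w [cMw _ cAw _ _] t; apply: cvgB; last exact: cAw.
    by apply: cvgM; exact: cMw.
  apply/funext => t; apply/funext => w; rewrite /M' /A' /regularized exprMn mulrBr.
  by congr (_ * _ - _); rewrite indicE; case: (_ \in _); rewrite ?expr1n ?expr0n.
have aA' : adapted F A' by exact: regularized_adapted.
have cA' w : continuous (A' ^~ w) by apply: regularized_continuous => -[].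
have A'0 w : A' 0 w = 0.
  rewrite /A' /regularized maxxx indicE.
  have [/set_mem[_ _ _ -> _]|_] := boolP (w \in Om).
    by rewrite mulr0.
  by rewrite mul0r.
have nA' w : nondecreasing_path (A' ^~ w).
  move=> s t s0 st; rewrite /A' /regularized indicE.
  have [/set_mem[_ _ _ _ H]|_] := boolP (w \in Om); last by rewrite !mul0r.
  by rewrite !mul1r !max_l// ?(le_trans s0)//; exact: H.
pose r w := fine (rho w).
have rho0 w : (0 <= rho w)%E by case: hrho => -[].
have r0 w : 0 <= r w by rewrite /r fine_ge0.
pose X w := running_max (fun t => `|M' t w|) (r w).
pose Y w := Num.sqrt (A' (r w) w).
have mX : measurable_fun setT X by exact: (measurable_running_sup hF rM hrho).
have mY : measurable_fun setT Y.
  apply: measurableT_comp; first exact: (continuous_measurable_fun (@sqrt_continuous R)).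
  exact: (measurable_at_random hF hrho).
have X0 w : 0 <= X w.
  apply: le_trans (normr_ge0 (M' 0 w)) _.
  have [_ cM' _ _] := rM.
  apply: (@le_running_max _ (fun t => `|M' t w|)); last by rewrite lexx r0.
  by move=> t; apply: cvg_norm; exact: cM'.
have Y0 w : 0 <= Y w by exact: sqrtr_ge0.
have A'r0 w : 0 <= A' (r w) w by rewrite -(A'0 w); exact: nA'.
have sqle l w : 0 <= l -> (l <= Y w) = (l ^+ 2 <= A' (r w) w).
  by move=> l0; rewrite /Y -{1}(ger0_norm l0) -sqrtr_sqr ler_sqrt.
have sqlt l w : 0 <= l -> (Y w < l) = (A' (r w) w < l ^+ 2).
  by move=> l0; rewrite !ltNge sqle.
have XY l : 0 < l -> \int[P]_w ((2 * l <= X w) && (Y w < delta * l))%:R <=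
    eps * \int[P]_w (l <= X w)%R%:R.
  move=> l0; have dl : 0 < (delta * l) ^+ 2 by rewrite exprn_gt0// mulr_gt0.
  have := good_lambda_martingale hF cF rM rL aA' cA' A'0 nA' hrho rhoy l0 dl.
  under eq_Rintegral do rewrite -sqlt ?mulr_ge0 ?(ltW d0) ?(ltW l0)//.
  rewrite (_ : 2 * (delta * l) ^+ 2 * _ =
     l ^+ 2 * (eps * \int[P]_w (l <= X w)%R%:R)); last by rewrite /eps; ring.
  by rewrite ler_pM2l// exprn_gt0.
have YX l : 0 < l -> \int[P]_w ((2 * l <= Y w) && (X w < delta * l))%:R <=
    eps * \int[P]_w (l <= Y w)%R%:R.
  move=> l0; have dl : 0 < delta * l by rewrite mulr_gt0.
  have l20 : 0 < l ^+ 2 by rewrite exprn_gt0.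
  have := good_lambda_bracket hF cF rM rL aA' cA' A'0 nA' hrho rhoy l20 dl.
  have -> : \int[P]_w (l ^+ 2 <= A' (fine (rho w)) w)%R%:R = \int[P]_w (l <= Y w)%R%:R.
    by apply: eq_Rintegral => w _; rewrite sqle// ltW.
  have -> : 4 * l ^+ 2 = (2 * l) ^+ 2 by ring.
  under eq_Rintegral do rewrite -sqle ?mulr_ge0 ?(ltW l0)//.
  have I0 : 0 <= \int[P]_w (l <= Y w)%R%:R by apply: Rintegral_ge0.
  have -> : (delta * l) ^+ 2 * \int[P]_w (l <= Y w)%R%:R =
     l ^+ 2 * (delta ^+ 2 * \int[P]_w (l <= Y w)%R%:R) by ring.
  rewrite [3 * _]mulrC -[l ^+ 2 * 3 * _]mulrA ler_pM2l//.
  set J := \int[P]_w _; have J0 : 0 <= J by apply: Rintegral_ge0.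
  have : 0 <= delta ^+ 2 * \int[P]_w (l <= Y w)%R%:R by rewrite mulr_ge0// sqr_ge0.
  rewrite /eps -mulrA; set K := delta ^+ 2 * _; move: J0; clear; lra.
have aeR : {ae P, forall w, Om w /\ rho w != +oo%E}.
  have [mrho _] := hrho.1.
  have aer : {ae P, forall w, rho w != +oo%E}.
    exists [set w | rho w = +oo%E]; split => //.
      rewrite -[X in measurable X]setTI.
    exact: (mrho measurableT [set +oo%E] (emeasurable_set1 _)).
    by move=> w /= /negP; rewrite negbK => /eqP.
  by move: aeOm aer; apply: filterS2.
have intX : (\int[P]_w (running_sup M rho w `^ p) = \int[P]_w (X w `^ p)%:E)%E.
  apply: (ae_eq_integral_complete hF cF).
    by apply/measurable_EFinP; exact: (measurableT_comp (measurable_powR p) mX).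
  move: aeR; apply: filterS => w [Ow rw].
  by rewrite (@running_sup_regularized _ _ _ Om)// ?poweR_EFin//; case: Ow.
have intY : (\int[P]_w (at_time A rho w `^ (p / 2)) = \int[P]_w (Y w `^ p)%:E)%E.
  apply: (ae_eq_integral_complete hF cF).
    by apply/measurable_EFinP; exact: (measurableT_comp (measurable_powR p) mY).
  move: aeR; apply: filterS => w [Ow rw].
  rewrite (@at_time_regularized _ _ _ Om)// poweR_EFin -/(r w) -/A' /Y -powR12_sqrt//.
  by rewrite -powRrM mulrC.
rewrite intX intY; split.
  rewrite lee_pdivrMl//.
  exact: (good_lambda_moment mY mX Y0 X0 p_gt0 d0 epsp YX).
exact: (good_lambda_moment mX mY X0 Y0 p_gt0 d0 epsp XY).
Unshelve. all: by end_near. Qed.
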